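(* Let $G$ be a finite simple connected graph satisfying condition $(\sharp)$. (1) Let $M$ be an indispensable monomial of $I_{\mathcal{A}_G}$ that is not quadratic. Then $\{\mathrm{supp}(M)\}$ is a connected component of $\Gamma_G$ if and only if every even closed walk $w$ of $G$ such that $M$ is a monomial of $B_w$ has an $\mathcal{F}_4$. (2) Every connected component of $\Gamma_G$ is either a vertex, an edge, or a $2$-simplex.
   Context: $G$ has vertices $v_1,\ldots,v_n$, edges $e_1,\ldots,e_m$; for $e_i=\{v_j,v_k\}$, $\mathbf a_i\in\mathbb{Z}^n$ has $1$ in positions $j,k$ and $0$ elsewhere; $\mathcal{A}_G=\{\mathbf a_i\}$; $I_{\mathcal{A}_G}\subset K[x_1,\ldots,x_m]$ is the kernel of $x_i\mapsto\mathbf t^{\mathbf a_i}$. Condition $(\sharp)$: no induced subgraph of $G$ consists of two vertex-disjoint odd cycles joined by a path of length $\ge1$. For an even closed walk $w=(e_{i_1},\ldots,e_{i_{2s}})$, $B_w=\prod_k x_{i_{2k-1}}-\prod_k x_{i_{2k}}$; edges in odd positions are odd edges of $w$, those in even positions even edges. A binomial $\mathbf x^{\mathbf u_+}-\mathbf x^{\mathbf u_-}$ is primitive if it is irreducible and there is no other binomial $\mathbf x^{\mathbf v_+}-\mathbf x^{\mathbf v_-}\in I_{\mathcal{A}_G}$ with $\mathbf x^{\mathbf v_+}\mid\mathbf x^{\mathbf u_+}$, $\mathbf x^{\mathbf v_-}\mid\mathbf x^{\mathbf u_-}$; $w$ is primitive if $B_w$ is. For a primitive walk $w=(\{v_1,v_2\},\{v_2,v_3\},\ldots,\{v_{2s},v_1\})$,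 a chord $e=\{v_k,v_l\}$ ($k<l$) is an edge of $G$ not in $w$ joining two vertices of $w$; it splits $w$ into $\gamma_1=(e_1,\ldots,e_{k-1},e,e_l,\ldots,e_{2s})$ and $\gamma_2=(e_k,\ldots,e_{l-1},e)$. It is a bridge if $v_k,v_l$ lie in different blocks (maximal subgraphs without cut vertex) of $w$ viewed as a subgraph, and it is an odd chord if it is not a bridge and both $\gamma_1,\gamma_2$ have odd length. Two odd chords $\{v_t,v_j\}$, $\{v_{t'},v_{j'}\}$ ($t<j$, $t'<j'$) cross effectively if $t'-t$ is odd and $t<t'<j<j'$ or $t'<t<j'<j$. An $\mathcal{F}_4$ of $w$ is a cycle $(e_i,e_j,e_k,e_l)$ of length $4$ where $e_i,e_k$ are edges of $w$ that are both odd or both even in $w$, and $e_j,e_l$ are odd chords of $w$ crossing effectively. A monomial $M$ is indispensable if every system of binomial generators of $I_{\mathcal{A}_G}$ contains a binomial having $M$ as a monomial. $\mathcal{T}_{\min}$: inclusion-minimal supports of indispensable monomials. $\Gamma_G$: simplicial complex on $\mathcal{T}_{\min}$ in which $\{E_1,\ldots,E_k\}$ is a face iff there exist monomials $M_l$ with $\mathrm{supp}(M_l)=E_l$ all of the same $\mathcal{A}_G$-degree. *)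

(* Defs.v *)
From HB Require Import structures.
From mathcomp Require Import all_boot all_order all_algebra fingraph.
From mathcomp Require Import mpoly.
From Stdlib Require Import Relations.

Set Implicit Arguments.
Unset Strict Implicit.
Unset Printing Implicit Defensive.

Import Order.TTheory GRing.Theory.
Local Open Scope ring_scope.

(* A graph G with vertices v_1..v_n (= 'I_n) and edges e_1..e_m (= 'I_m);
   [ends i] is the 2-element vertex set of edge e_i.                     *)
Section Graph.
Variables (n m : nat) (ends : 'I_m -> {set 'I_n}).

Definition simple_graph : Prop :=
  (forall i, #|ends i| = 2%N) /\ injective ends.

Definition adjG : rel 'I_n := fun x y => [exists i, ends i == [set x; y]].

Definition connected_graph : Prop := forall x y : 'I_n, connect adjG x y.

Definition cyc_edge (c : seq 'I_n) (x y : 'I_n) : bool :=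
  ((x, y) \in zip c (rot 1 c)) || ((y, x) \in zip c (rot 1 c)).
Definition path_edge (p : seq 'I_n) (x y : 'I_n) : bool :=
  ((x, y) \in zip p (behead p)) || ((y, x) \in zip p (behead p)).

Definition odd_cycle (c : seq 'I_n) : bool :=
  [&& uniq c, odd (size c), (3 <= size c)%N & cycle adjG c].

(* the induced subgraph of G on the vertices of c1, c2, p consists exactly
   of two vertex-disjoint odd cycles c1, c2 joined by the path p of length
   >= 1 (p goes from a vertex of c1 to a vertex of c2, its inner vertices
   lying outside both cycles). *)
Definition two_odd_cycles_with_path (c1 c2 p : seq 'I_n) : Prop :=
  [/\ odd_cycle c1 /\ odd_cycle c2 /\ [disjoint c1 & c2],
      uniq p /\ (2 <= size p)%N /\ sorted adjG p,
      (exists2 x, head x p \in c1 & last x p \in c2),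
      (forall x, x \in drop 1 (take (size p).-1 p) -> (x \notin c1) && (x \notin c2))
      & forall x y, x \in c1 ++ c2 ++ p -> y \in c1 ++ c2 ++ p ->
          adjG x y = [|| cyc_edge c1 x y, cyc_edge c2 x y | path_edge p x y]].

Definition cond_sharp : Prop :=
  forall c1 c2 p, ~ two_odd_cycles_with_path c1 c2 p.

Variable K : fieldType.

Definition toric_map (P : {mpoly K[m]}) : {mpoly K[n]} :=
  comp_mpoly [tuple \prod_(v in ends i) 'X_v | i < m] P.

Definition in_toric (P : {mpoly K[m]}) : Prop := toric_map P = 0.

Definition binomial (P : {mpoly K[m]}) : Prop :=
  exists u v : 'X_{1..m}, P = 'X_[u] - 'X_[v].

Definition in_ideal (S : seq {mpoly K[m]}) (P : {mpoly K[m]}) : Prop :=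
  exists c : 'I_(size S) -> {mpoly K[m]},
    P = \sum_(i < size S) c i * S`_i.

Definition binomial_generators (S : seq {mpoly K[m]}) : Prop :=
  (forall B, B \in S -> binomial B) /\
  (forall P, in_toric P <-> in_ideal S P).

Definition monomial_of (M : 'X_{1..m}) (P : {mpoly K[m]}) : bool :=
  M \in msupp P.

Definition indispensable (M : 'X_{1..m}) : Prop :=
  forall S, binomial_generators S -> exists2 B, B \in S & monomial_of M B.

Definition supp (M : 'X_{1..m}) : {set 'I_m} := [set i | (0 < M i)%N].

Definition quadratic (M : 'X_{1..m}) : bool := mdeg M == 2%N.

Definition Tmin (E : {set 'I_m}) : Prop :=
  (exists2 M, indispensable M & supp M = E) /\
  ~ (exists2 M, indispensable M & supp M \proper E).

(* A_G-degree of the monomial x^u : sum_i u_i a_i *)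
Definition adeg (u : 'X_{1..m}) (v : 'I_n) : nat :=
  (\sum_(i < m | v \in ends i) u i)%N.

Definition face (F : {set {set 'I_m}}) : Prop :=
  F != set0 /\ (forall E, E \in F -> Tmin E) /\
  exists Mon : {set 'I_m} -> 'X_{1..m},
    (forall E, E \in F -> supp (Mon E) = E) /\
    (forall E E', E \in F -> E' \in F -> adeg (Mon E) =1 adeg (Mon E')).

Definition gadj (E E' : {set 'I_m}) : Prop := E != E' /\ face [set E; E'].

Definition component (C : {set {set 'I_m}}) : Prop :=
  [/\ C != set0, (forall E, E \in C -> Tmin E),
      (forall E E', E \in C -> E' \in C -> clos_refl_trans _ gadj E E')
    & forall E E', E \in C -> gadj E E' -> E' \in C].

(* w = (e_{i_1}, ..., e_{i_2s}) through vertices vs = (v_1, ..., v_2s):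
   edge es_k joins vs_k and vs_{k+1} (cyclically). Positions are 0-based,
   so the paper's odd edges are those at even 0-based positions.        *)
Definition even_closed_walk (es : seq 'I_m) (vs : seq 'I_n) : Prop :=
  [/\ size es = size vs, (0 < size es)%N, ~~ odd (size es)
    & all2 (fun e xy => ends e == [set xy.1; xy.2]) es (zip vs (rot 1 vs))].

Definition odd_pos (es : seq 'I_m) : seq bool :=
  [seq ~~ odd k | k <- iota 0 (size es)].

Definition B_walk (es : seq 'I_m) : {mpoly K[m]} :=
  \prod_(e <- mask (odd_pos es) es) 'X_e
  - \prod_(e <- mask (map negb (odd_pos es)) es) 'X_e.

Definition odd_edge (es : seq 'I_m) (e : 'I_m) : bool :=
  e \in mask (odd_pos es) es.
Definition even_edge (es : seq 'I_m) (e : 'I_m) : bool :=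
  e \in mask (map negb (odd_pos es)) es.

Section Blocks.
Variables (es : seq 'I_m) (vs : seq 'I_n).

Definition sub_rel (S : {set 'I_n}) (F : {set 'I_m}) : rel 'I_n :=
  fun x y => [&& x \in S, y \in S & [exists i in F, ends i == [set x; y]]].

Definition sg_connected (S : {set 'I_n}) (F : {set 'I_m}) : bool :=
  [forall x in S, forall y in S, connect (sub_rel S F) x y].

Definition is_subgraph_of_w (S : {set 'I_n}) (F : {set 'I_m}) : bool :=
  [&& S \subset [set x in vs], F \subset [set e in es]
    & [forall i in F, ends i \subset S]].

Definition cut_vertex (S : {set 'I_n}) (F : {set 'I_m}) (v : 'I_n) : bool :=
  (v \in S) && ~~ sg_connected (S :\ v) [set i in F | v \notin ends i].

Definition nonsep (S : {set 'I_n}) (F : {set 'I_m}) : bool :=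
  [&& S != set0, sg_connected S F & [forall v, ~~ cut_vertex S F v]].

Definition block (S : {set 'I_n}) (F : {set 'I_m}) : Prop :=
  [/\ is_subgraph_of_w S F, nonsep S F &
      forall S' F', is_subgraph_of_w S' F' -> nonsep S' F' ->
        S \subset S' -> F \subset F' -> S' = S /\ F' = F].

Definition same_block (x y : 'I_n) : Prop :=
  exists S F, [/\ block S F, x \in S & y \in S].
End Blocks.

Definition at_pos (vs : seq 'I_n) (a : nat) (x : 'I_n) : bool :=
  (a < size vs)%N && (nth x vs a == x).

Definition chord (es : seq 'I_m) (vs : seq 'I_n) (e : 'I_m) (a b : nat) : Prop :=
  exists x y, [/\ (a < b)%N, at_pos vs a x, at_pos vs b y,
                  e \notin es & ends e = [set x; y]].

Definition bridge (es : seq 'I_m) (vs : seq 'I_n) (e : 'I_m) (a b : nat) : Prop :=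
  chord es vs e a b /\
  exists x y, [/\ at_pos vs a x, at_pos vs b y & ~ same_block es vs x y].

(* gamma_1 = (e_1..e_{k-1}, e, e_l..e_2s), gamma_2 = (e_k..e_{l-1}, e),
   with k = a+1, l = b+1 *)
Definition gamma1_length (es : seq 'I_m) (a b : nat) : nat := (a + 1 + (size es - b))%N.
Definition gamma2_length (a b : nat) : nat := (b - a + 1)%N.

Definition odd_chord (es : seq 'I_m) (vs : seq 'I_n) (e : 'I_m) (a b : nat) : Prop :=
  [/\ chord es vs e a b, ~ bridge es vs e a b,
      odd (gamma1_length es a b) & odd (gamma2_length a b)].

(* t' - t odd (as integers) and the chords interleave *)
Definition cross_effectively (t j t' j' : nat) : bool :=
  odd (t' + t) && ((t < t' < j)%N && (j < j')%N || (t' < t < j')%N && (j' < j)%N).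

Definition cycle4 (ei ej ek el : 'I_m) : Prop :=
  exists a b c d : 'I_n, [/\ uniq [:: a; b; c; d],
    ends ei = [set a; b], ends ej = [set b; c], ends ek = [set c; d]
    & ends el = [set d; a]].

Definition has_F4 (es : seq 'I_m) (vs : seq 'I_n) : Prop :=
  exists ei ej ek el : 'I_m, exists t j t' j' : nat,
    [/\ cycle4 ei ej ek el,
        ei \in es /\ ek \in es,
        (odd_edge es ei && odd_edge es ek) || (even_edge es ei && even_edge es ek),
        odd_chord es vs ej t j /\ odd_chord es vs el t' j'
      & cross_effectively t j t' j'].

End Graph.

(* Main.v *)
Require Import Defs.
From HB Require Import structures.
From mathcomp Require Import all_boot all_order all_algebra fingraph zify.
From mathcomp Require Import mpoly.
From Stdlib Require Import Classical_Prop Relation_Operators.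

(** A monomial is indispensable iff it is minimal, for divisibility, among the
    monomials whose fibre contains another monomial.  Such an [M] is one half
    of an even closed walk [w].  Along [w] the alternating sums of edge degrees
    telescope, so every set of positions whose alternating degree is that of a
    few edges of [G] produces a monomial of a nontrivial fibre; minimality of
    [M] then excludes even chords, repeated vertices of the same parity, and
    edges between the two lobes at a repeated vertex.  If a vertex is repeated,
    condition (sharp) forces both lobes to be chordless odd cycles, so that the
    edge degrees of [w] satisfy a single linear relation and the other half of
    [w] is indispensable too.  If [w] is an even cycle whose other half is not
    indispensable, an indispensable divisor of that half is matched by odd
    chords; a shortest one is effectively crossed by another one, and
    minimality of [M] turns these two chords into an F_4.  The same argument
    bounds the number of indispensable monomials of a fibre by two, or by the
    three perfect matchings of four points in the quadratic case. *)

(** Condition (sharp) concerns induced subgraphs, whereas minimality of [M] only produces closed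
    walks that may have repetitions and chords. This gap is bridged by shortest odd closed walks
    with a stem, which are induced. A generating system is a finite list, so showing that a
    non-minimal monomial is dispensable requires finitely many binomials that avoid it and still
    generate. They exist because binomials of degree at most [n] suffice. A face only asks for some
    monomials with the given supports in a common degree, while the walk arguments compare
    squarefree monomials. The passage rests on a dichotomy: either an indispensable monomial is a
    matching, whose degree is determined by its vertex set, or it comes from a walk with a repeated
    vertex, and then its vertex set carries at most two indispensable monomials. *)

Set Implicit Arguments.
Unset Strict Implicit.
Unset Printing Implicit Defensive.
Import Order.TTheory GRing.Theory Num.Theory.
Local Open Scope nat_scope.

(** * Minimal lollipops *)

Section Lollipop.
Variables (V : finType) (r : rel V).
Hypotheses (rC : ssrbool.symmetric r) (rI : irreflexive r).

Fixpoint walkb n x y : bool :=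
  if n is n'.+1 then [exists z, r x z && walkb n' z y] else x == y.

Lemma walkb_cat a b x y z : walkb a x y -> walkb b y z -> walkb (a + b) x z.
Proof.
elim: a x => [|a IH] x /=; first by move/eqP->.
move=> /existsP[t /andP[rxt wt]] wb; apply/existsP; exists t.
by rewrite rxt IH.
Qed.

Lemma walkb1 x y : walkb 1 x y = r x y.
Proof.
by apply/existsP/idP => [[z /andP[h /eqP<-]] //|h]; exists y; rewrite h /=.
Qed.

Lemma walkb_sym n x y : walkb n x y -> walkb n y x.
Proof.
elim: n x y => [|n IH] x y; first by rewrite /= eq_sym.
move=> /existsP[z /andP[rxz wz]].
by rewrite -addn1; apply: walkb_cat (IH _ _ wz) _; rewrite walkb1 rC.
Qed.

Lemma walkb_fun n x y : walkb n x y ->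
  exists s : nat -> V, [/\ s 0 = x, s n = y & forall i, i < n -> r (s i) (s i.+1)].
Proof.
elim: n x => [|n IH] x /=; first by move/eqP->; exists (fun=> y).
move=> /existsP[z /andP[rxz /IH[s [s0 sn rs]]]].
exists (fun i => if i is j.+1 then s j else x); split=> // -[|i] ltin /=.
  by rewrite s0.
exact: rs.
Qed.

Lemma fun_walkb (s : nat -> V) i j : i <= j ->
  (forall k, i <= k < j -> r (s k) (s k.+1)) -> walkb (j - i) (s i) (s j).
Proof.
move=> /subnKC <-; rewrite addKn; elim: (j - i) => [|n IH] rs.
  by rewrite addn0 /=.
rewrite -addn1; apply: walkb_cat (IH _) _ => [k hk|]; first by apply: rs; lia.
by rewrite addn1 addnS walkb1; apply: rs; lia.
Qed.

(** Neither walk need be simple and [d = 0] is allowed, which makes lollipops easy to exhibit. *)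
Definition lollipop x d k := odd k && [exists y, walkb d x y && walkb k y y].

Lemma lollipopI x y d k : odd k -> walkb d x y -> walkb k y y -> lollipop x d k.
Proof. by move=> ok h1 h2; rewrite /lollipop ok /=; apply/existsP; exists y; rewrite h1. Qed.

(* Minimize first the number [d + k] of vertices, then the length [d] of the
   stem: a repeated vertex or a chord would give a smaller lollipop. *)
Lemma induced_lollipop x d0 k0 : lollipop x d0 k0 ->
  exists d k s, [/\ odd k /\ 3 <= k, s 0 = x /\ s (d + k) = s d,
    forall i, i < d + k -> r (s i) (s i.+1),
    forall i j, i < j < d + k -> s i != s j &
    forall i j, i < j < d + k -> r (s i) (s j) ->
      j = i.+1 \/ i = d /\ j.+1 = d + k].
Proof.
move=> lol0.
have exN : exists N, [exists d : 'I_N.+1, lollipop x d (N - d)].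
  exists (d0 + k0); apply/existsP.
  have lt0 : d0 < (d0 + k0).+1 by lia.
  by exists (Ordinal lt0); rewrite /= addKn.
case: (ex_minnP exN) => N /existsP[[d1 /= ltd1] lol1] minN.
case: (ex_minnP (ex_intro (fun d => (d <= N) && lollipop x d (N - d)) d1 _)) => [|d /andP[ledN lol] mind].
  by rewrite lol1 andbT.
have [k Nk] : exists k, N = d + k by exists (N - d); lia.
(* Lexicographic minimality of [(d + k, d)]; the second component matters because some shortcuts
   only shorten the stem. *)
have {minN mind} mn d' k' : lollipop x d' k' -> d + k < d' + k' \/ (d + k = d' + k' /\ d <= d').
  move=> l'.
  have : N <= d' + k'.
    apply: minN; apply/existsP; have lt' : d' < (d' + k').+1 by lia.
    by exists (Ordinal lt'); rewrite /= addKn.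
  rewrite leq_eqVlt => /orP[/eqP eN|]; last by rewrite Nk; left.
  right; split; first by rewrite -Nk.
  by apply: mind; rewrite {1 2}eN addKn l' andbT; lia.
move: lol; rewrite Nk addKn => /andP[oddk /existsP[y /andP[/walkb_fun[s1 [s10 s1d rs1]] /walkb_fun[s2 [s20 s2k rs2]]]]].
pose s i := if i <= d then s1 i else s2 (i - d).
have rs i : i < d + k -> r (s i) (s i.+1).
  rewrite /s => lti; case: (ltngtP i d) => [ltid|gtid|->].
  - by apply: rs1.
  - by rewrite subSn 1?ltnW //; apply: rs2; lia.
  - by rewrite s1d -s20 subSn // subnn; apply: rs2; lia.
have s0 : s 0 = x by rewrite /s.
have sN : s (d + k) = s d.
  rewrite /s leqnn s1d; case: ifP => [h|_]; last by rewrite addKn.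
  by have -> : d + k = d by lia.
have w i j : i <= j -> j <= d + k -> walkb (j - i) (s i) (s j).
  by move=> h1 h2; apply: fun_walkb => // l hl; apply: rs; lia.
have wx i : i <= d + k -> walkb i x (s i).
  by move=> h; have := w 0 i (leq0n _) h; rewrite subn0 s0.
have wC i j : i <= j -> j <= d + k -> walkb (j - i) (s j) (s i).
  by move=> h1 h2; apply: walkb_sym; apply: w.
have wd j : d <= j -> j <= d + k -> walkb (d + k - j) (s d) (s j).
  by move=> h1 h2; rewrite -sN; apply: wC.
have wd' j : d <= j -> j <= d + k -> walkb (d + k - j) (s j) (s d).
  by move=> h1 h2; apply: walkb_sym; apply: wd.
have bad y' d' k' : odd k' -> walkb d' x y' -> walkb k' y' y' ->
    (d' + k' < d + k) || (d' + k' == d + k) && (d' < d) -> False.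
  by move=> o h1 h2; have := mn _ _ (lollipopI o h1 h2); lia.
exists d, k, s; split => //.
- split=> //; rewrite ltnNge; apply/negP => lek.
  have ek : k = 1 by lia.
  by have := rs d; rewrite -addn1 -{2}ek sN rI ek => h; apply: notF (h _); lia.
- move=> i j ltij; apply/eqP => eij.
  (* A repetition is removed by cutting the stem, by keeping the arc from [i] to [j] when it is odd,
     or else by going round the rest of the cycle, which then closes up with odd length. *)
  case: (leqP j d) => [lejd|ltdj].
    apply: (bad (s d) (i + (d - j)) k) => //.
    + by apply: walkb_cat (wx i _) _; [lia|rewrite eij; apply: w; lia].
    + by have := wd d; rewrite addKn; apply; lia.
    + lia.
  case o: (odd (j - i)).
    apply: (bad (s i) i (j - i)) => //; first by apply: wx; lia.
      by rewrite {2}eij; apply: w; lia.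
    lia.
  case: (leqP d i) => [ledi|ltid].
    apply: (bad (s d) d ((i - d) + (d + k - j))); [lia|apply: wx; lia| |lia].
    by apply: walkb_cat (w d i _ _) _; [lia|lia|rewrite eij; apply: wd'; lia].
  apply: (bad (s i) i ((d - i) + (d + k - j))); [lia|apply: wx; lia| |lia].
  by apply: walkb_cat (w i d _ _) _; [lia|lia|rewrite eij; apply: wd; lia].
- move=> i j ltij rij.
  have rji : r (s j) (s i) by rewrite rC.
  have [->|ne1] := eqVneq j i.+1; first by left.
  have [/andP[/eqP h1 /eqP h2]|ne2] := boolP ((i == d) && (j.+1 == d + k)); first by right.
  exfalso.
  case: (leqP j d) => [lejd|ltdj].
    apply: (bad (s d) (i + (1 + (d - j))) k) => //.
    + apply: walkb_cat (wx i _) _; first by lia.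
      by apply: (walkb_cat (y := s j)); [rewrite walkb1|apply: w; lia].
    + by have := wd d; rewrite addKn; apply; lia.
    + lia.
  case o: (odd (j - i)); last first.
    case lt1 : ((j.+1 < d + k) || (i < d)).
      apply: (bad (s i) i ((j - i) + 1)); [lia|apply: wx; lia| |lia].
      by apply: walkb_cat (w i j _ _) _; [lia|lia|rewrite walkb1].
    (* Here [s j] is the last vertex before the return to [s d], and [i > d]. As [j - i] is even,
       [i] is not [d + 1], so the sum really drops. *)
    apply: (bad (s j) (d + (d + k - j)) ((j - i) + 1)); [lia| | |lia].
      by apply: walkb_cat (wx d _) _; [lia|apply: wd; lia].
    rewrite addnC; apply: walkb_cat (w i j _ _); [by rewrite walkb1|lia|lia].
  case: (leqP d i) => [ledi|ltid].
    apply: (bad (s d) d ((i - d) + (1 + (d + k - j)))); [lia|apply: wx; lia| |lia].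
    apply: walkb_cat (w d i _ _) _; [lia|lia|].
    by apply: (walkb_cat (y := s j)); [rewrite walkb1|apply: wd'; lia].
  apply: (bad (s i) i ((d - i) + (d + k - j) + 1)); [lia|apply: wx; lia| |lia].
  apply: (walkb_cat (y := s j)); last by rewrite walkb1.
  by apply: walkb_cat (w i d _ _) _; [lia|lia|apply: wd; lia].
Qed.

End Lollipop.

(** * Condition (sharp) *)

Section ZipIota.
Variables (T : eqType) (U : nat -> T) (N : nat).
Hypothesis injU : forall i j, i < N -> j < N -> U i = U j -> i = j.

Lemma mem_zip_iota a n i j : a + n < N -> i < N -> j < N ->
  ((U i, U j) \in zip (map U (iota a n.+1)) (behead (map U (iota a n.+1))))
    = (a <= i < a + n) && (j == i.+1).
Proof.
move=> + ltiN ltjN; elim: n a => [|n IH] a lta; first by rewrite in_nil; lia.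
rewrite [zip _ _]/= in_cons; have {}IH := IH a.+1; rewrite /= in IH; rewrite IH; last by lia.
apply/orP/andP => [[/eqP[/injU ei /injU ej]|]|[h1 h2]].
- by have := ei _ _; have := ej _ _; lia.
- lia.
- have [ei|ne] := eqVneq i a; [left|right]; last by lia.
  by rewrite (eqP h2) ei.
Qed.

Lemma zip_rcons_shift (x : T) t y :
  zip (x :: t) (rcons t y) = rcons (zip (x :: t) t) (last x t, y).
Proof. by elim: t x => //= z t IH x; rewrite -IH. Qed.

Lemma mem_zip_rot_iota a n i j : a + n < N -> i < N -> j < N ->
  ((U i, U j) \in zip (map U (iota a n.+1)) (rot 1 (map U (iota a n.+1))))
    = ((a <= i < a + n) && (j == i.+1)) || ((i == a + n) && (j == a)).
Proof.
move=> lta ltiN ltjN; rewrite -mem_zip_iota //=.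
have -> : rot 1 (U a :: map U (iota a.+1 n)) = rcons (map U (iota a.+1 n)) (U a).
  by rewrite rot1_cons.
rewrite zip_rcons_shift mem_rcons in_cons orbC; congr (_ || _).
have -> : last (U a) (map U (iota a.+1 n)) = U (a + n).
  by rewrite last_map; congr U; case: n {lta} => [|n]; rewrite ?addn0 // -addSnnS -nth_last size_iota nth_iota.
apply/eqP/andP => [[/injU ei /injU ej]|[/eqP-> /eqP->]//].
by have := ei _ _; have := ej _ _; lia.
Qed.
End ZipIota.

Section Barbell.
Variables (n m : nat) (ends : 'I_m -> {set 'I_n}).
Local Notation adj := (adjG ends).

(* The three arguments of [two_odd_cycles_with_path] are consecutive overlapping
   segments of one sequence of distinct vertices. *)
Lemma barbell (U : nat -> 'I_n) k1 d k2 N :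
  odd k1 -> odd k2 -> 3 <= k1 -> 3 <= k2 -> 0 < d -> N = (k1 + d + k2).-1 ->
  (forall i j, i < N -> j < N -> U i = U j -> i = j) ->
  (forall i j, i < N -> j < N -> adj (U i) (U j) =
     [|| j == i.+1, i == j.+1, (i == 0) && (j == k1.-1), (j == 0) && (i == k1.-1),
         (i == N - k2) && (j == N.-1) | (j == N - k2) && (i == N.-1)]) ->
  two_odd_cycles_with_path ends (map U (iota 0 k1)) (map U (iota (k1.-1 + d) k2))
    (map U (iota k1.-1 d.+1)).
Proof.
move=> o1 o2 le1 le2 lt0d eN injU adjU.
have injm (s : seq nat) : (forall i, i \in s -> i < N) -> uniq s -> uniq (map U s).
  move=> sN us; rewrite map_inj_in_uniq // => i j /sN hi /sN hj; exact: injU.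
have memU i a l : i < N -> a + l <= N -> (U i \in map U (iota a l)) = (a <= i < a + l).
  move=> ltiN hl; apply/mapP/idP => [[j]|h].
    by rewrite mem_iota => hj /injU ->//; lia.
  by exists i; rewrite ?mem_iota.
have allU a l x : x \in map U (iota a l) -> exists2 i, a <= i < a + l & x = U i.
  by case/mapP => i; rewrite mem_iota => hi ->; exists i.
have [l1 e1] : exists l, k1 = l.+1 by exists k1.-1; lia.
have [l2 e2] : exists l, k2 = l.+1 by exists k2.-1; lia.
have cyc a l : 1 < l -> a + l < N -> adj (U (a + l)) (U a) ->
    cycle adj (map U (iota a l.+1)).
  move=> lt1l ltN h /=; rewrite rcons_path.
  have -> : last (U a) (map U (iota a.+1 l)) = U (a + l).
    by rewrite last_map; congr U; case: l {ltN h} lt1l => [|l _]; rewrite // -addSnnS -nth_last size_iota nth_iota.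
  rewrite h andbT; elim: l a {h lt1l} ltN => //= l IH a ltN.
  by rewrite IH ?andbT ?adjU; lia.
have srt a l : a + l < N -> sorted adj (map U (iota a l.+1)).
  elim: l a => //= l IH a ltN; rewrite adjU ?eqxx /=; [|lia|lia].
  by apply: IH; lia.
split.
- split; [|split].
  + rewrite /odd_cycle size_map size_iota injm ?iota_uniq => [|i|]; [|rewrite mem_iota; lia|by []].
    by rewrite o1 le1 e1 cyc //; [lia|lia|rewrite adjU; lia].
  + rewrite /odd_cycle size_map size_iota injm ?iota_uniq => [|i|]; [|rewrite mem_iota; lia|by []].
    by rewrite o2 le2 e2 cyc //; [lia|lia|rewrite adjU; lia].
  + rewrite disjoint_has; apply/hasPn => x /allU[i hi ->].
    by rewrite memU; lia.
- split; first by apply: injm (iota_uniq _ _) => i; rewrite mem_iota; lia.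
  by rewrite size_map size_iota srt //; lia.
- exists (U 0); first by rewrite /= memU; lia.
  rewrite /= last_map; set z := last _ _.
  have -> : z = k1.-1 + d.
    by rewrite /z; case: d {eN adjU z} lt0d => // d _; rewrite -addSnnS -nth_last size_iota nth_iota.
  by rewrite memU; lia.
- move=> x; rewrite size_map size_iota -map_take -map_drop => /mapP[i hi ->].
  have : k1.-1 < i < k1.-1 + d.
    move: hi; rewrite take_iota drop_iota mem_iota; lia.
  by move=> h; rewrite !memU; lia.
- have hU x : x \in map U (iota 0 k1) ++ map U (iota (k1.-1 + d) k2) ++ map U (iota k1.-1 d.+1) -> exists2 i, i < N & x = U i.
    by rewrite !mem_cat => /or3P[] /allU[i hi ->]; exists i => //; lia.
  move=> x y /hU[i hi ->] /hU[j hj ->].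
  have ltN : l1 + d + l2 < N by lia.
  have ltN' : l1 + d < N by lia.
  have c1E : cyc_edge (map U (iota 0 k1)) (U i) (U j) =
      [|| i.+1 == j, j.+1 == i, (i == 0) && (j == l1) | (j == 0) && (i == l1)] && (i < k1) && (j < k1).
    by rewrite /cyc_edge e1 !(mem_zip_rot_iota injU) //; lia.
  have c2E : cyc_edge (map U (iota (l1 + d) k2)) (U i) (U j) =
      [|| i.+1 == j, j.+1 == i, (i == l1 + d) && (j == l1 + d + l2) | (j == l1 + d) && (i == l1 + d + l2)] && (l1 + d <= i) && (l1 + d <= j).
    rewrite /cyc_edge e2 !(mem_zip_rot_iota injU) //.
    clear o1 o2; set a := l1 + d; have hi' : i <= a + l2 by lia.
    have hj' : j <= a + l2 by lia.
    have ge2 : 2 <= l2 by lia.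
    clear -hi' hj' ge2; apply/idP/idP; first by case/orP => /orP[]; lia.
    by case/andP => /andP[/or4P[]]; lia.
  have pE : path_edge (map U (iota l1 d.+1)) (U i) (U j) =
      [|| (i.+1 == j) && (l1 <= i) && (j <= l1 + d) | (j.+1 == i) && (l1 <= j) && (i <= l1 + d)].
    by rewrite /path_edge !(mem_zip_iota injU) //; clear; lia.
  have -> : k1.-1 = l1 by rewrite e1.
  rewrite adjU // c1E c2E pE; clear -hi hj e1 e2 eN lt0d le1 le2.
  have {1 2}-> : k1.-1 = l1 by rewrite e1.
  have -> : N - k2 = l1 + d by lia.
  have -> : N.-1 = l1 + d + l2 by lia.
  have hi' : i <= l1 + d + l2 by lia.
  have hj' : j <= l1 + d + l2 by lia.
  subst k1 k2; clear -hi' hj' lt0d le1 le2.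
  apply/idP/idP; first by case/or4P => [||| /orP[|/orP[]]]; lia.
  by case/or3P => [/andP[/andP[/or4P[]]]|/andP[/andP[/or4P[]]]|/orP[]]; lia.
Qed.
End Barbell.

Section TwoLollipops.
Variables (n m : nat) (ends : 'I_m -> {set 'I_n}).
Hypothesis ends2 : forall i, #|ends i| = 2.
Local Notation adj := (adjG ends).

Lemma adjC : ssrbool.symmetric adj.
Proof. by move=> x y; rewrite /adjG setUC. Qed.

Lemma adjI : irreflexive adj.
Proof.
move=> x; apply/existsP => -[i /eqP e].
by have := ends2 i; rewrite e setUid cards1.
Qed.

Definition sadj (S : {set 'I_n}) : rel 'I_n :=
  fun x y => [&& x \in S, y \in S & adj x y].

Lemma sadjC S : ssrbool.symmetric (sadj S).
Proof. by move=> x y; rewrite /sadj adjC andbCA. Qed.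

Lemma sadjI S : irreflexive (sadj S).
Proof. by move=> x; rewrite /sadj adjI !andbF. Qed.

(** Induced lollipops glued at [x] give two disjoint odd cycles joined by a path through [x]. Having
    only one neighbour in [S1] keeps [x] off the first cycle, so this path has positive length. *)
Lemma two_lollipops (S1 S2 : {set 'I_n}) x d1 k1 d2 k2 : cond_sharp ends ->
  (forall y z, y \in S1 -> z \in S2 -> y = z \/ adj y z -> y = x \/ z = x) ->
  (forall y z, y \in S1 -> z \in S1 -> adj x y -> adj x z -> y = z) ->
  lollipop (sadj S1) x d1 k1 -> lollipop (sadj S2) x d2 k2 -> False.
Proof.
move=> sharp sep uniqx.
case/(induced_lollipop (@sadjC S1) (@sadjI S1)) => {}d1 [{}k1 [s1 [[o1 k1_3] [s10 s1d] rs1 inj1 ind1]]].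
case/(induced_lollipop (@sadjC S2) (@sadjI S2)) => {}d2 [{}k2 [s2 [[o2 k2_3] [s20 s2d] rs2 inj2 ind2]]].
have S1P i : i < d1 + k1 -> s1 i \in S1 by move/rs1 => /and3P[].
have S2P i : i < d2 + k2 -> s2 i \in S2 by move/rs2 => /and3P[].
have a1 i j : i < j < d1 + k1 -> adj (s1 i) (s1 j) = (j == i.+1) || ((i == d1) && (j.+1 == d1 + k1)).
  move=> hij; apply/idP/idP => [h|].
    have [|->|[-> ->]] := ind1 _ _ hij; last by rewrite !eqxx orbT.
      by apply/and3P; split => //; apply: S1P; lia.
    by rewrite eqxx.
  case/orP => [/eqP->|/andP[/eqP ei /eqP ej]].
    by have /and3P[] : sadj S1 (s1 i) (s1 i.+1) by apply: rs1; lia.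
  by rewrite adjC ei -s1d -ej; have /and3P[] : sadj S1 (s1 j) (s1 j.+1) by apply: rs1; lia.
have a2 i j : i < j < d2 + k2 -> adj (s2 i) (s2 j) = (j == i.+1) || ((i == d2) && (j.+1 == d2 + k2)).
  move=> hij; apply/idP/idP => [h|].
    have [|->|[-> ->]] := ind2 _ _ hij; last by rewrite !eqxx orbT.
      by apply/and3P; split => //; apply: S2P; lia.
    by rewrite eqxx.
  case/orP => [/eqP->|/andP[/eqP ei /eqP ej]].
    by have /and3P[] : sadj S2 (s2 i) (s2 i.+1) by apply: rs2; lia.
  by rewrite adjC ei -s2d -ej; have /and3P[] : sadj S2 (s2 j) (s2 j.+1) by apply: rs2; lia.
have d1_gt0 : 0 < d1.
  rewrite lt0n; apply/eqP => d10; move: s1d a1 inj1 S1P; rewrite d10 add0n => s1k a1 inj1 S1P.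
  have /negP[] := inj1 1 k1.-1 ltac:(lia); apply/eqP; apply: uniqx; try (apply: S1P; lia).
    by rewrite -s10 a1 //; lia.
  by rewrite -s10 a1; lia.
(* The vertices are listed from the end of the first cycle back to [x], at position [M], and then
   along the second lollipop; [N] counts [x] once. *)
pose M := (d1 + k1).-1.
pose U i := if i <= M then s1 (M - i) else s2 (i - M).
pose N := (k1 + (d1 + d2) + k2).-1.
have adjlt i j : i < j -> j < N -> U i <> U j /\ adj (U i) (U j) =
     [|| j == i.+1, (i == 0) && (j == k1.-1) | (i == N - k2) && (j == N.-1)].
  move=> ltij ltjN; rewrite /U; have [lejM|ltMj] := leqP j M.
    rewrite ifT; last by lia.
    split; first by apply/eqP; rewrite eq_sym; apply: inj1; rewrite /M in lejM *; lia.
    rewrite adjC a1; last by rewrite /M in lejM *; lia.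
    by rewrite /N /M in ltjN lejM *; clear -ltij ltjN lejM o1 o2 k1_3 k2_3; apply/idP/idP; lia.
  have [leMi|] := leqP M i.
    have -> : (if i <= M then s1 (M - i) else s2 (i - M)) = s2 (i - M).
      case: ifP => // leiM; have -> : i = M by lia.
      by rewrite subnn s10 s20.
    split; first by apply/eqP; apply: inj2; rewrite /N /M in ltjN leMi *; lia.
    rewrite a2; last by rewrite /N /M in ltjN leMi *; lia.
    by rewrite /N /M in ltjN leMi ltMj *; clear -ltij ltjN leMi ltMj o1 o2 k1_3 k2_3; apply/idP/idP; lia.
  move=> ltiM; rewrite ifT; last by lia.
  have bad : s1 (M - i) = s2 (j - M) \/ adj (s1 (M - i)) (s2 (j - M)) -> False.
    move=> h; case: (sep (s1 (M - i)) (s2 (j - M)) _ _ h).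
    - by apply: S1P; rewrite /M; lia.
    - by apply: S2P; rewrite /N /M in ltjN *; lia.
    - by rewrite -s10 => /esym/eqP; apply/negP; apply: inj1; rewrite /M in ltiM *; lia.
    - by rewrite -s20 => /esym/eqP; apply/negP; apply: inj2; rewrite /N /M in ltjN ltMj *; lia.
  split; first by move=> h; apply: bad; left.
  transitivity false; first by apply/negbTE/negP => h; apply: bad; right.
  by rewrite /N /M in ltjN ltMj ltiM *; clear -ltij ltjN ltMj ltiM o1 o2 k1_3 k2_3; lia.
have injU i j : i < N -> j < N -> U i = U j -> i = j.
  move=> hi hj e; case: (ltngtP i j) => // lt.
    by case: (adjlt i j lt hj).
  by case: (adjlt j i lt hi) => /(_ (esym e)).
apply: (sharp _ _ _ (barbell (U := U) o1 o2 k1_3 k2_3 (d := d1 + d2) _ (erefl N) injU _)); first by lia.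
move=> i j hi hj; case: (ltngtP i j) => [lt|lt|<-].
- have [_ ->] := adjlt _ _ lt hj; clear -lt hi hj o1 o2 k1_3 k2_3 d1_gt0.
  rewrite /N in hi hj *; apply/idP/idP; last by case/or4P => [||| /orP[|/orP[]]]; lia.
  by case/or3P; lia.
- have [_ e] := adjlt _ _ lt hi; rewrite adjC e; clear -lt hi hj o1 o2 k1_3 k2_3 d1_gt0.
  rewrite /N in hi hj *; apply/idP/idP; last by case/or4P => [||| /orP[|/orP[]]]; lia.
  by case/or3P; lia.
- rewrite adjI; clear -hi o1 o2 k1_3 k2_3 d1_gt0; rewrite /N in hi *; apply/esym/negbTE/negP.
  by case/or4P => [||| /orP[|/orP[]]]; lia.
Qed.

End TwoLollipops.

(** * Degrees and fibres *)

Section Degrees.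
Variables (n m : nat) (ends : 'I_m -> {set 'I_n}).
Hypothesis ends2 : forall i, #|ends i| = 2.
Implicit Types (u v w M N : 'X_{1..m}) (x : 'I_n).

Lemma adegD u v x : adeg ends (u + v)%MM x = adeg ends u x + adeg ends v x.
Proof. by rewrite /adeg -big_split; apply: eq_bigr => i _; rewrite mnmDE. Qed.

Lemma adeg0 x : adeg ends 0%MM x = 0.
Proof. by rewrite /adeg big1 // => i _; rewrite mnm0E. Qed.

Lemma adegU i x : adeg ends U_(i)%MM x = (x \in ends i).
Proof.
rewrite /adeg; case: (boolP (x \in ends i)) => xi.
  rewrite (bigD1 i) //= mnm1E eqxx big1 // => j /andP[_ ne].
  by rewrite mnm1E eq_sym (negbTE ne).
by rewrite big1 // => j xj; rewrite mnm1E; case: eqP => // e; rewrite e xj in xi.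
Qed.

Lemma adeg_sum (I : eqType) (r : seq I) (P : pred I) (F : I -> 'X_{1..m}) x :
  adeg ends (\sum_(i <- r | P i) F i)%MM x = \sum_(i <- r | P i) adeg ends (F i) x.
Proof.
by elim/big_rec2: _ => [|i a b _ <-]; rewrite ?adeg0 ?adegD.
Qed.

Lemma sum_adeg u : \sum_x adeg ends u x = 2 * mdeg u.
Proof.
rewrite /adeg mdegE big_distrr (exchange_big_dep xpredT) //=.
by apply: eq_bigr => i _; rewrite sum_nat_const ends2.
Qed.

Lemma adeg_le u v x : (u <= v)%MM -> adeg ends u x <= adeg ends v x.
Proof. by move=> /submK <-; rewrite adegD leq_addl. Qed.

Lemma adegB u v x : (u <= v)%MM -> adeg ends (v - u)%MM x = adeg ends v x - adeg ends u x.
Proof. by move=> h; rewrite -{2}(submK h) adegD addnK. Qed.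

Lemma adeg_gt0 u x : 0 < adeg ends u x -> exists2 i, x \in ends i & 0 < u i.
Proof.
rewrite /adeg lt0n sum_nat_eq0 negb_forall => /existsP[i].
by rewrite negb_imply -lt0n => /andP[xi ui]; exists i.
Qed.

Lemma leq_adeg u i x : x \in ends i -> u i <= adeg ends u x.
Proof. by move=> xi; rewrite /adeg (bigD1 i) //= leq_addr. Qed.

Definition eqdeg u v := [forall x, adeg ends u x == adeg ends v x].

Lemma eqdegP u v : reflect (forall x, adeg ends u x = adeg ends v x) (eqdeg u v).
Proof. by apply: (iffP forallP) => h x; apply/eqP; rewrite ?h. Qed.

Lemma eqdeg_refl u : eqdeg u u.
Proof. exact/eqdegP. Qed.

Lemma eqdegC u v : eqdeg u v = eqdeg v u.
Proof. by apply/eqdegP/eqdegP => h x; rewrite h. Qed.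

Lemma eqdeg_trans v u w : eqdeg u v -> eqdeg v w -> eqdeg u w.
Proof. by move=> /eqdegP h /eqdegP h'; apply/eqdegP => x; rewrite h h'. Qed.

Lemma eqdeg_mdeg u v : eqdeg u v -> mdeg u = mdeg v.
Proof.
move=> /eqdegP h; apply/eqP; rewrite -(eqn_pmul2l (isT : 0 < 2)) -!sum_adeg.
by apply/eqP/eq_bigr.
Qed.

Lemma eqdegD u v u' v' : eqdeg u u' -> eqdeg v v' -> eqdeg (u + v)%MM (u' + v')%MM.
Proof. by move=> /eqdegP h /eqdegP h'; apply/eqdegP => x; rewrite !adegD h h'. Qed.

Lemma eqdegB u v u' v' : (u' <= u)%MM -> (v' <= v)%MM ->
  eqdeg u v -> eqdeg u' v' -> eqdeg (u - u')%MM (v - v')%MM.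
Proof. by move=> l l' /eqdegP h /eqdegP h'; apply/eqdegP => x; rewrite !adegB // h h'. Qed.

Definition movable u := exists2 v, v != u & eqdeg u v.

Definition minmov M := movable M /\ forall u, (u <= M)%MM -> movable u -> u = M.

Lemma le_mdeg_eq u v : (u <= v)%MM -> mdeg v <= mdeg u -> u = v.
Proof.
move=> h; rewrite -(submK h) mdegD => le.
have : mdeg (v - u)%MM == 0 by lia.
by rewrite mdeg_eq0 => /eqP->; rewrite add0m.
Qed.

Lemma le_mdeg u v : (u <= v)%MM -> mdeg u <= mdeg v.
Proof. by move=> h; rewrite -(submK h) mdegD leq_addl. Qed.

Lemma minmov_below u : movable u -> exists2 M, minmov M & (M <= u)%MM.
Proof.
have [k] := ubnP (mdeg u); elim: k u => // k IH u ltk mu.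
have [[w [lw mw ne]]|h] := classic (exists w, [/\ (w <= u)%MM, movable w & w <> u]).
  have [|M mM lM] := IH w _ mw; last by exists M => //; apply: lepm_trans lw.
  suff : mdeg w < mdeg u by lia.
  by rewrite ltnNge; apply/negP => /(le_mdeg_eq lw).
exists u; last exact: lepm_refl.
split=> // w lw mw; apply: NNPP => ne; apply: h; by exists w.
Qed.

(** A common variable could be cancelled from both monomials, leaving a proper divisor of [M] that
    is still movable. *)
Lemma minmov_disjoint M N i : minmov M -> N != M -> eqdeg M N -> 0 < M i -> N i = 0.
Proof.
move=> [_ minM] ne e Mi; apply/eqP; rewrite -leqn0 leqNgt; apply/negP => Ni.
have lM : (U_(i) <= M)%MM by rewrite lep1mP -lt0n.
have lN : (U_(i) <= N)%MM by rewrite lep1mP -lt0n.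
have : (M - U_(i))%MM = M.
  apply: minM; first exact: lem_subr.
  exists (N - U_(i))%MM; last by apply: eqdegB => //; apply: eqdeg_refl.
  by apply: contra ne => /eqP h; rewrite -(submK lN) h submK.
by move/mnmP/(_ i); rewrite mnmBE mnm1E eqxx; lia.
Qed.

End Degrees.

(** * Alternating sums along a closed walk *)

Lemma perm_arc L i j : i <= j <= L ->
  perm_eq (iota i (j - i) ++ (iota 0 i ++ iota j (L - j))) (iota 0 L).
Proof.
move=> h; rewrite perm_catCA.
have -> : iota 0 L = iota 0 i ++ iota i (j - i) ++ iota j (L - j) => //.
have e1 : i + (j - i) = j by lia.
by rewrite -{2}e1 -iotaD -{2}[i]add0n -iotaD; congr iota; lia.
Qed.

Lemma perm_2arcs L i j k l : i <= j <= k -> k <= l <= L ->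
  perm_eq ((iota i (j - i) ++ iota k (l - k)) ++ (iota 0 i ++ iota j (k - j) ++ iota l (L - l))) (iota 0 L).
Proof.
move=> h h'.
have -> : iota 0 L = iota 0 i ++ iota i (j - i) ++ iota j (k - j) ++ iota k (l - k) ++ iota l (L - l).
  have e1 : i + (j - i) = j by lia.
  have e2 : j + (k - j) = k by lia.
  have e3 : k + (l - k) = l by lia.
  rewrite -{2}e3 -iotaD -{2}e2 -iotaD -{2}e1 -iotaD -{2}[i]add0n -iotaD; congr iota; lia.
apply/permP => p; rewrite !count_cat; lia.
Qed.

Section Walks.
Variables (n m : nat) (ends : 'I_m -> {set 'I_n}).
Hypothesis ends2 : forall i, #|ends i| = 2.
Hypothesis ends_inj : injective ends.
Implicit Types (M N R : 'X_{1..m}) (x : 'I_n) (c : bool) (T : seq nat).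
Local Notation minmov := (minmov ends).
Local Notation eqdeg := (eqdeg ends).
Local Notation adj := (adjG ends).

Definition sg (b : bool) : int := if b then (-1)%R else 1%R.

Lemma ends_neq i x y : ends i = [set x; y] -> x != y.
Proof. by move=> e; have := ends2 i; rewrite e cards2; case: (x != y). Qed.

Lemma mem_ends i x y z : ends i = [set y; z] -> (x \in ends i) = (x == y) + (x == z) :> nat.
Proof.
move=> e; have := ends_neq e; rewrite e !inE.
by case: (eqVneq x y) => [->|//]; case: (eqVneq y z).
Qed.

(* Indices are periodic rather than bounded, so that rotating a walk is a shift. *)
Definition cwalk L (e : nat -> 'I_m) (v : nat -> 'I_n) :=
  [/\ 0 < L, ~~ odd L, forall k, ends (e k) = [set v k; v k.+1],
      forall k, v (k + L) = v k & forall k, e (k + L) = e k].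

Section Arcs.
Variables (e : nat -> 'I_m) (v : nat -> 'I_n).
Hypothesis ev : forall k, ends (e k) = [set v k; v k.+1].

(** Positions rather than edges are selected, so repeated edges count with multiplicity. Positions
    start at 0: parity [false] gives the first, third, ... edges. *)
Definition part T c : 'X_{1..m} := (\sum_(k <- T | odd k == c) U_(e k))%MM.

Definition altdeg T x : int := (\sum_(k <- T) sg (odd k) * (x \in ends (e k))%:Z)%R.

Lemma altdeg_cat T1 T2 x : altdeg (T1 ++ T2) x = (altdeg T1 x + altdeg T2 x)%R.
Proof. by rewrite /altdeg big_cat. Qed.

Lemma part_cat T1 T2 c : part (T1 ++ T2) c = (part T1 c + part T2 c)%MM.
Proof. by rewrite /part big_cat. Qed.

Lemma part_perm T1 T2 c : perm_eq T1 T2 -> part T1 c = part T2 c.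
Proof. by move=> h; apply: perm_big. Qed.

Lemma mdeg_part T c : mdeg (part T c) = count (fun k => odd k == c) T.
Proof.
rewrite /part mdeg_sum -sum1_count; apply: eq_bigr => k _; exact: mdeg1.
Qed.

Lemma size_part T c : size T = mdeg (part T c) + mdeg (part T (~~ c)).
Proof.
rewrite !mdeg_part -(count_predC (fun k => odd k == c)); congr (_ + _).
by apply: eq_count => k /=; case: (odd k); case: c.
Qed.

Lemma partE T c i : (part T c i > 0) = [exists k : seq_sub T, (odd (val k) == c) && (e (val k) == i)].
Proof.
rewrite /part mnm_sumE; apply/idP/existsP => [|[[k kT] /= /andP[ok /eqP ek]]].
  rewrite lt0n sum_nat_seq_eq0 -has_predC => /hasP[k kT /=].
  rewrite negb_imply mnm1E => /andP[ok]; rewrite eqb0 negbK => ek.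
  by exists (SeqSub kT); rewrite /= ok ek.
rewrite lt0n sum_nat_seq_eq0 -has_predC; apply/hasP; exists k => //=.
by rewrite ok /= mnm1E ek eqxx.
Qed.

Lemma partP T c i : reflect (exists k, [/\ k \in T, odd k = c & e k = i]) (part T c i > 0).
Proof.
rewrite partE; apply: (iffP existsP) => [[[k kT] /= /andP[/eqP ok /eqP ek]]|[k [kT ok ek]]].
  by exists k.
by exists (SeqSub kT); rewrite /= ok ek !eqxx.
Qed.

Lemma altdegE T x : altdeg T x =
  ((adeg ends (part T false) x)%:Z - (adeg ends (part T true) x)%:Z)%R.
Proof.
rewrite /altdeg /part !adeg_sum; elim: T => [|k T IH]; first by rewrite !big_nil.
rewrite !big_cons {}IH !adegU /sg.
move: (\sum_(i <- T | odd i == false) _) (\sum_(i <- T | odd i == true) _) => a b.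
by case: (odd k); case: (x \in _) => /=; lia.
Qed.

(** Consecutive edges have opposite signs, so the inner vertices cancel. *)
Lemma altdeg_iota i l x : altdeg (iota i l) x =
  (sg (odd i) * (x == v i)%:Z - sg (odd (i + l)) * (x == v (i + l))%:Z)%R.
Proof.
elim: l i => [|l IH] i; first by rewrite /altdeg big_nil addn0 subrr.
rewrite /= /altdeg big_cons -/(altdeg _ _) IH addSnnS (mem_ends _ (ev i)) PoszD /=.
by rewrite /sg; case: (odd i) => /=; lia.
Qed.

End Arcs.

Section MinWalk.
Variables (L : nat) (e : nat -> 'I_m) (v : nat -> 'I_n) (c : bool).
Hypothesis W : cwalk L e v.
Definition wpart b := part e (iota 0 L) b.

Lemma ev k : ends (e k) = [set v k; v k.+1]. Proof. by case: W. Qed.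
Lemma vL k : v (k + L) = v k. Proof. by case: W. Qed.
Lemma vL0 : v L = v 0. Proof. by rewrite -(vL 0). Qed.
Lemma eL k : e (k + L) = e k. Proof. by case: W. Qed.
Lemma evenL : ~~ odd L. Proof. by case: W. Qed.
Lemma L_gt0 : 0 < L. Proof. by case: W. Qed.

Lemma wpart_eqdeg : eqdeg (wpart c) (wpart (~~ c)).
Proof.
apply/eqdegP => x; have := altdegE e (iota 0 L) x; rewrite /sg.
rewrite (altdeg_iota ev) add0n vL0 /= (negbTE evenL) subrr /wpart.
by case: c => /=; lia.
Qed.

Hypothesis minM : minmov (wpart c).
Hypothesis neq : wpart false != wpart true.

Lemma wpart_disjoint i : 0 < wpart c i -> wpart (~~ c) i = 0.
Proof.
move=> h; apply: (minmov_disjoint minM) h; last exact: wpart_eqdeg.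
by case: c => //=; rewrite eq_sym.
Qed.

(* The hypotheses say that [x^{part T c} - x^{part T (~~ c) + R}] is in the toric
   ideal, and [part T c] divides the minimal monomial [wpart c]. *)
Lemma balanced_split T T' R : perm_eq (T ++ T') (iota 0 L) ->
  (forall x, altdeg e T x = (sg c * (adeg ends R x)%:Z)%R) ->
  size T' = mdeg R \/ size T = mdeg R /\ R = part e T c.
Proof.
move=> pT hT.
have wT b : wpart b = (part e T b + part e T' b)%MM by rewrite -part_cat; apply/esym/part_perm.
have dT : eqdeg (part e T c) (part e T (~~ c) + R)%MM.
  by apply/eqdegP => x; have := hT x; rewrite altdegE adegD; case: c; rewrite /=; lia.
have dW := eqdeg_mdeg ends2 wpart_eqdeg.
have mT := eqdeg_mdeg ends2 dT.
(* If the two sides agree, [part e T (~~ c)] divides both halves, which are coprime. Otherwise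
   minimality makes [part e T c] the whole half, and counting degrees gives the size of [T']. *)
have [h|ne] := eqVneq (part e T c) (part e T (~~ c) + R)%MM; [right|left].
  have T0 : part e T (~~ c) = 0%MM.
    apply/mnmP => i; rewrite mnm0E; apply/eqP; rewrite -leqn0 leqNgt; apply/negP => hi.
    have : wpart (~~ c) i = 0.
      by apply: wpart_disjoint; rewrite wT mnmDE h mnmDE; lia.
    by rewrite wT mnmDE; lia.
  rewrite (size_part e T c) h T0 add0m; split=> //.
  by rewrite mdeg0 addn0.
have eT : part e T c = wpart c.
  apply: (proj2 minM); first by rewrite wT lem_addr.
  by exists (part e T (~~ c) + R)%MM; rewrite // eq_sym.
have T'0 : mdeg (part e T' c) = 0 by move: eT; rewrite wT => /(congr1 mdeg); rewrite mdegD; lia.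
move: dW; rewrite !wT !mdegD (size_part e T' c); rewrite mdegD in mT; lia.
Qed.

(** Complementary sets of positions have opposite alternating degrees, so a wrong sign is corrected
    by exchanging [T] and [T']. *)
Lemma balanced_split_sg s T T' R : perm_eq (T ++ T') (iota 0 L) ->
  (forall x, altdeg e T x = (sg s * (adeg ends R x)%:Z)%R) ->
  [/\ s = c & size T' = mdeg R \/ size T = mdeg R /\ R = part e T c] \/
  [/\ s = ~~ c & size T = mdeg R \/ size T' = mdeg R /\ R = part e T' c].
Proof.
move=> pT hT; have [sc|sc] := eqVneq s c.
  by left; split=> //; apply: balanced_split => // x; rewrite hT sc.
have {}sc : s = ~~ c by case: s sc {hT}; case: c.
right; split=> //; apply: balanced_split; first by rewrite perm_catC.
move=> x; have : altdeg e (T ++ T') x = 0%R.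
  rewrite /altdeg (perm_big _ pT) -/(altdeg _ _ _) (altdeg_iota ev) add0n vL0 /=.
  by rewrite (negbTE evenL) subrr.
rewrite altdeg_cat hT sc; case: c => /=; lia.
Qed.

Lemma closed_split T T' : perm_eq (T ++ T') (iota 0 L) -> (forall x, altdeg e T x = 0%R) ->
  size T = 0 \/ size T' = 0.
Proof.
move=> pT hT; case: (balanced_split_sg (s := c) (R := 0%MM) pT).
- by move=> x; rewrite hT adeg0 mulr0.
- by rewrite mdeg0; case=> _ [|[]]; auto.
- by rewrite mdeg0; case=> _ [|[]]; auto.
Qed.

Lemma chord_split s i T T' : perm_eq (T ++ T') (iota 0 L) ->
  (forall x, altdeg e T x = (sg s * (x \in ends i)%:Z)%R) -> size T = 1 \/ size T' = 1.
Proof.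
move=> pT hT; case: (balanced_split_sg (s := s) (R := U_(i)%MM) pT).
- by move=> x; rewrite hT adegU.
- by rewrite mdeg1; case=> _ [|[]]; auto.
- by rewrite mdeg1; case=> _ [|[]]; auto.
Qed.

(** As [i] is not an edge of the walk, [R] cannot be a part of the walk, which discards one
    alternative for each sign. *)
Lemma two_chords_split s i j T T' : perm_eq (T ++ T') (iota 0 L) ->
  (forall k, e k != i) ->
  (forall x, altdeg e T x = (sg s * ((x \in ends i)%:Z + (x \in ends j)%:Z))%R) ->
  s = c /\ size T' = 2 \/ s = ~~ c /\ size T = 2.
Proof.
move=> pT ni hT.
have nR T1 : (U_(i) + U_(j))%MM = part e T1 c -> False.
  move/mnmP/(_ i); rewrite mnmDE mnm1E eqxx => h.
  have /partP[k [_ _ /eqP]] : 0 < part e T1 c i by lia.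
  by rewrite (negbTE (ni k)).
case: (balanced_split_sg (s := s) (R := (U_(i) + U_(j))%MM) pT).
- by move=> x; rewrite hT adegD !adegU.
- by rewrite mdegD !mdeg1; case=> -> [->|[_ /nR]//]; left.
- by rewrite mdegD !mdeg1; case=> -> [->|[_ /nR]//]; right.
Qed.

End MinWalk.
End Walks.

(** * Walks through a minimal monomial *)

Section MinimalWalks.
Variables (n m : nat) (ends : 'I_m -> {set 'I_n}).
Hypothesis ends2 : forall i, #|ends i| = 2.
Hypothesis ends_inj : injective ends.
Implicit Types (M N R : 'X_{1..m}) (x : 'I_n) (c : bool).
Local Notation minmov := (minmov ends).
Local Notation eqdeg := (eqdeg ends).
Local Notation adj := (adjG ends).

Definition minwalk L (e : nat -> 'I_m) (v : nat -> 'I_n) c :=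
  [/\ cwalk ends L e v, minmov (wpart L e c) & wpart L e false != wpart L e true].

Lemma wpart_shift1 L e (v : nat -> 'I_n) c : cwalk ends L e v ->
  wpart L (e \o succn) c = wpart L e (~~ c).
Proof.
move=> W; have eL0 : e L = e 0 by rewrite -(eL W 0).
have := L_gt0 W; have := evenL W; case: L W eL0 => // L W eL0 oL _.
rewrite /wpart /part.
have -> : (\sum_(k <- iota 0 L.+1 | odd k == c) U_((e \o succn) k))%MM =
          (\sum_(k <- iota 1 L.+1 | odd k == ~~ c) U_(e k))%MM.
  rewrite (iotaDl 1 0) big_map; apply: eq_big => k; rewrite add1n //=.
  by case: (odd k); case: c.
have -> : iota 1 L.+1 = iota 1 L ++ [:: L.+1] by rewrite -[L.+1]addn1 iotaD add1n addn1.
rewrite big_cat /= big_cons [in RHS]big_cons big_nil.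
have -> : odd L.+1 = false by apply/negbTE.
rewrite eL0; case: c => /=; last by rewrite addm0.
by rewrite addm0 addmC.
Qed.

Lemma cwalk_shift1 L e v : cwalk ends L e v -> cwalk ends L (e \o succn) (v \o succn).
Proof. by case=> h1 h2 h3 h4 h5; split => // k; [exact: h3|exact: (h4 k.+1)|exact: (h5 k.+1)]. Qed.

Lemma minwalk_shift1 L e v c : minwalk L e v c ->
  minwalk L (e \o succn) (v \o succn) (~~ c).
Proof.
case=> W h1 h2; split; first exact: cwalk_shift1.
  by rewrite (wpart_shift1 _ W) negbK.
by rewrite !(wpart_shift1 _ W) /= eq_sym.
Qed.

Lemma minwalk_shift s L e v c : minwalk L e v c ->
  minwalk L (e \o addn s) (v \o addn s) (odd s (+) c) /\
  forall b, wpart L (e \o addn s) b = wpart L e (odd s (+) b).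
Proof.
elim: s e v c => [|s IH] e v c mw; first by [].
have [W _ _] := mw; have [mw' ew] := IH _ _ _ (minwalk_shift1 mw).
split; first by have := mw'; rewrite addbN -addNb.
by move=> b; rewrite [LHS]ew (wpart_shift1 _ W) /= -addNb.
Qed.

Section Fix.
Variables (L : nat) (e : nat -> 'I_m) (v : nat -> 'I_n) (c : bool).
Hypothesis MW : minwalk L e v c.
Let W : cwalk ends L e v. Proof. by case: MW. Qed.
Let minM : minmov (wpart L e c). Proof. by case: MW. Qed.
Let neq : wpart L e false != wpart L e true. Proof. by case: MW. Qed.

(** The arc from [i] to [j] would be a closed even walk, neither empty nor everything. *)
Lemma no_even_repeat i j : i < j < L -> ~~ odd (j - i) -> v i <> v j.
Proof.
move=> hij oij eij.
case: (closed_split ends2 W minM neq (perm_arc (L := L) (i := i) (j := j) _)); first lia.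
- move=> x; rewrite (altdeg_iota ends2 (ev W)).
  have -> : i + (j - i) = j by lia.
  by rewrite eij (_ : odd j = odd i) ?subrr //; lia.
- by rewrite size_iota; lia.
- by rewrite size_cat !size_iota; lia.
Qed.

(** Each of the two arcs is completed by [f] to an even closed walk; minimality forces one of them
    to be a single edge. *)
Lemma no_even_chord i j f : i < j < L -> odd (j - i) -> ends f = [set v i; v j] ->
  j = i.+1 \/ i = 0 /\ j.+1 = L.
Proof.
move=> hij oij ef.
case: (chord_split (s := odd i) (i := f) ends2 W minM neq (perm_arc (L := L) (i := i) (j := j) _)); first lia.
- move=> x; rewrite (altdeg_iota ends2 (ev W)) (mem_ends ends2 _ ef).
  have -> : i + (j - i) = j by lia.
  rewrite (_ : odd j = ~~ odd i); last by lia.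
  by rewrite /sg; case: (odd i); case: (_ == _); case: (_ == _).
- by rewrite size_iota; lia.
- by rewrite size_cat !size_iota; lia.
Qed.

Lemma adjP x y : adj x y -> exists f, ends f = [set x; y].
Proof. by case/existsP => f /eqP; exists f. Qed.

Lemma eq_e k f : ends f = [set v k; v k.+1] -> f = e k.
Proof. by rewrite -(ev W) => /ends_inj. Qed.

Section Lobes.
Variable b : nat.
Hypotheses (ltb : 0 < b < L) (ob : odd b) (vb : v 0 = v b).

(** As [b] is odd, the repeated vertex cancels in the alternating degree of the arcs from it to
    [v p] and to [v q]. A coincidence at odd [q - p] would make this degree zero, and an edge at
    even [q - p] would have this degree up to sign. *)
Lemma lobes_separated p q : 0 < p < b -> b < q < L -> v p <> v q /\ ~~ adj (v p) (v q).
Proof.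
move=> hp hq.
have aT x : altdeg ends e (iota 0 (p - 0) ++ iota b (q - b)) x =
    (- (sg (odd p) * (x == v p)%:Z + sg (odd q) * (x == v q)%:Z))%R.
  rewrite altdeg_cat !(altdeg_iota ends2 (ev W)).
  have -> : b + (q - b) = q by lia.
  by rewrite add0n subn0 /= ob vb /sg; case: (odd p); case: (odd q); case: (_ == _); case: (_ == _); case: (_ == _).
have pT := @perm_2arcs L 0 p b q ltac:(lia) ltac:(lia).
case: (boolP (odd (q - p))) => o.
- split.
    move=> epq; case: (closed_split ends2 W minM neq pT); last 2 first.
    + by rewrite size_cat !size_iota; lia.
    + by rewrite !size_cat !size_iota; lia.
    move=> x; rewrite aT epq (_ : odd q = ~~ odd p); last by lia.
    by rewrite /sg; case: (odd p); case: (_ == _).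
  apply/negP => /adjP[f ef].
  by case: (no_even_chord _ o ef); lia.
- split; first by move=> epq; apply: (@no_even_repeat p q) => //; lia.
  apply/negP => /adjP[f ef].
  case: (chord_split (s := ~~ odd p) (i := f) ends2 W minM neq pT).
  + move=> x; rewrite aT (mem_ends ends2 _ ef) (_ : odd q = odd p); last by lia.
    by rewrite /sg; case: (odd p); case: (_ == _); case: (_ == _).
  + by rewrite size_cat !size_iota; lia.
  + by rewrite !size_cat !size_iota; lia.
Qed.

(** One of the two positions [0], [b] of the repeated vertex is at odd distance from [r], so
    [no_even_chord] applies. *)
Lemma lobe_nbr r : 0 < r < b -> adj (v 0) (v r) -> r = 1 \/ r.+1 = b.
Proof.
move=> hr /adjP[f ef]; case: (boolP (odd r)) => o.
  by case: (@no_even_chord 0 r f _ _ ef); rewrite ?subn0; lia.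
have {}ef : ends f = [set v r; v b] by rewrite ef vb setUC.
by case: (no_even_chord _ _ ef); lia.
Qed.

Definition vset lo hi : {set 'I_n} :=
  [set y | [exists k : 'I_L.+1, (lo <= k <= hi) && (v k == y)]].

Lemma vsetP lo hi y : reflect (exists k, [/\ k <= L, lo <= k <= hi & v k = y]) (y \in vset lo hi).
Proof.
rewrite inE; apply: (iffP existsP) => [[[k ltk] /= /andP[h /eqP<-]]|[k [lek h <-]]].
  by exists k.
by exists (Ordinal (lek : k < L.+1)); rewrite /= h eqxx.
Qed.

Lemma adjv k : adj (v k) (v k.+1).
Proof. by apply/existsP; exists (e k); rewrite (ev W). Qed.

(* Otherwise the lobe [(0, b)] contains an odd closed walk missing one of the two
   neighbours of [v 0]; with the other lobe this gives two lollipops at [v 0]. *)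
Lemma lobe_simple p q : cond_sharp ends -> 0 < p -> p < q -> q < b ->
  ~ (odd (q - p) /\ v p = v q \/ ~~ odd (q - p) /\ adj (v p) (v q)).
Proof.
move=> sharp p0 ltpq ltqb hpq.
(* The other lobe has odd length [L - b] and is a lollipop with stem of length 0. *)
have wS2 : lollipop (sadj ends (vset b L)) (v 0) 0 (L - b).
  apply: (lollipopI (y := v 0)); [have := evenL W; lia|exact: eqxx|].
  rewrite {1}vb -(vL0 W); apply: fun_walkb => [|k hk]; first lia.
  by rewrite /sadj adjv andbT; apply/andP; split; apply/vsetP; eexists; (split; last reflexivity); lia.
(* The window from [lo] to [hi] contains [p] and [q] and, if possible, omits one of the positions
   [1], [b.-1], where the neighbours of [v 0] sit. If [p = 1] and [q = b.-1], then [q - p] is odd,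
   so [v p = v q] and the two neighbours coincide. *)
have [lo [hi [/andP[l0 lp] qh hb hx hw]]] : exists lo hi, [/\ 0 < lo <= p, q <= hi, hi < b,
    forall r r', lo <= r <= hi -> lo <= r' <= hi -> adj (v 0) (v r) -> adj (v 0) (v r') -> v r = v r'
    & exists2 y, (exists d, walkb (sadj ends (v 0 |: vset lo hi)) d (v 0) y) & y = v p \/ y = v q].
  have inS lo hi k : 0 < lo -> hi < b -> lo <= k <= hi -> v k \in v 0 |: vset lo hi.
    by move=> h1 h2 h3; apply/setU1P; right; apply/vsetP; exists k; split=> //; lia.
  have [lt1p|] := ltnP 1 p.
    exists p, b.-1; split; try lia.
      by move=> r r' h h' /lobe_nbr a /lobe_nbr a'; rewrite (_ : r = r') //; have := a _; have := a' _; lia.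
    exists (v q); last by right.
    exists (b - q); apply: walkb_sym; first exact: sadjC.
    rewrite {2}vb; apply: fun_walkb => [|k hk]; first lia.
    rewrite /sadj adjv andbT inS //=; try lia.
    have [->|ne] := eqVneq k.+1 b; first by rewrite -vb !inE eqxx.
    by apply: inS; lia.
  move=> le1p; have ep : p = 1 by lia.
  have [ltq|leq] := ltnP q b.-1.
    exists 1, q; split; try lia.
      by move=> r r' h h' /lobe_nbr a /lobe_nbr a'; rewrite (_ : r = r') //; have := a _; have := a' _; lia.
    exists (v p); last by left.
    exists 1; rewrite walkb1 ep /sadj adjv andbT setU11 /=; apply: inS; lia.
  have eq : q = b.-1 by lia.
  exists 1, b.-1; split; try lia.
    have v1 : v 1 = v b.-1 by case: hpq => -[o]; rewrite -eq -ep //; lia.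
    move=> r r' h h' /lobe_nbr a /lobe_nbr a'.
    have [->|er] := a ltac:(lia); have [->|er'] := a' ltac:(lia) => //.
    + by rewrite v1; congr v; lia.
    + by rewrite v1; congr v; lia.
    + by congr v; lia.
  exists (v p); last by left.
  exists 1; rewrite walkb1 ep /sadj adjv andbT setU11 /=; apply: inS; lia.
set S1 := v 0 |: vset lo hi in hw.
have S1P y : y \in S1 -> y = v 0 \/ exists2 k, lo <= k <= hi & y = v k.
  by move=> /setU1P[|/vsetP[k [_ h <-]]]; [left|right; exists k].
have inS k : lo <= k <= hi -> v k \in S1.
  by move=> h; apply/setU1P; right; apply/vsetP; exists k; split=> //; lia.
have wpq : walkb (sadj ends S1) (q - p) (v p) (v q).
  by apply: fun_walkb => [|k hk]; [lia|rewrite /sadj adjv !inS; lia].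
(* [k] is [q - p] for a coincidence and [q - p + 1] for an edge. Both base points are recorded
   because the stem reaches only one of them. *)
have [k ok wk] : exists2 k, odd k & walkb (sadj ends S1) k (v p) (v p) /\ walkb (sadj ends S1) k (v q) (v q).
  case: hpq => -[o epq]; first by exists (q - p); rewrite // -epq {2 4}epq.
  have aqp : walkb (sadj ends S1) 1 (v q) (v p).
    by rewrite walkb1 /sadj adjC epq !inS; lia.
  exists ((q - p) + 1); first lia.
  by split; [|rewrite addnC]; apply: walkb_cat; eauto.
case: hw => y [d wd] hy.
apply: (two_lollipops ends2 (S1 := S1) (S2 := vset b L) (x := v 0) (d1 := d) (k1 := k) sharp _ _ _ wS2).
- move=> y1 y2 /S1P[->|[r hr ->]]; first by left.
  move=> /vsetP[s [sL hs <-]] h; right.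
  have [->|ns] := eqVneq s b; first by rewrite vb.
  have [->|nsL] := eqVneq s L; first by rewrite (vL0 W).
  have [h1 /negP h2] : v r <> v s /\ ~~ adj (v r) (v s) by apply: lobes_separated; lia.
  by case: h.
- move=> y1 y2 /S1P[->|[r hr ->]]; first by rewrite adjI.
  move=> /S1P[->|[s hs ->]]; first by rewrite adjI.
  exact: hx.
- by apply: lollipopI wd _ => //; case: hy wk => -> [].
Qed.

End Lobes.
End Fix.
End MinimalWalks.

(** * Repeated vertices *)

Section FigureEight.
Variables (n m : nat) (ends : 'I_m -> {set 'I_n}).
Hypothesis ends2 : forall i, #|ends i| = 2.
Hypothesis ends_inj : injective ends.
Implicit Types (M N R : 'X_{1..m}) (x : 'I_n) (c : bool).
Local Notation minmov := (minmov ends).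
Local Notation eqdeg := (eqdeg ends).
Local Notation adj := (adjG ends).
Local Notation minwalk := (minwalk ends).

Lemma cwalk_mod L e v k : cwalk ends L e v -> v (k %% L) = v k /\ e (k %% L) = e k.
Proof.
move=> W; rewrite {2 4}(divn_eq k L); elim: (k %/ L) => [|q [-> ->]]; first by [].
by rewrite mulSn -addnA [L + _]addnC (vL W) (eL W).
Qed.

Section Fix.
Variables (L : nat) (e : nat -> 'I_m) (v : nat -> 'I_n) (c : bool).
Hypothesis MW : minwalk L e v c.
Let W : cwalk ends L e v. Proof. by case: MW. Qed.

Section Simple.
(** Position 0 is exempt, so that both even cycles and walks whose only repeated vertex is [v 0] are
    covered. *)
Hypothesis vI : forall i j, 0 < i < j -> j < L -> v i <> v j.

Lemma e_neq i j : i < j < L -> e i <> e j.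
Proof.
move=> hij eij; have [_ minM neq] := MW.
case: (boolP (odd (j - i))) => o.
  have h1 : 0 < wpart L e (odd i) (e i) by apply/partP; exists i; rewrite mem_iota; split=> //; lia.
  have h2 : 0 < wpart L e (odd j) (e i) by apply/partP; exists j; rewrite mem_iota; split=> //; lia.
  have [ci|ci] := eqVneq (odd i) c.
    have := wpart_disjoint ends2 W minM neq (i := e i); rewrite -ci => /(_ h1).
    by rewrite (_ : ~~ odd i = odd j) => [h|]; [rewrite h in h2|lia].
  have := wpart_disjoint ends2 W minM neq (i := e i).
  rewrite (_ : c = odd j) => [/(_ h2)|]; last by clear -o hij ci; case: c ci; lia.
  by rewrite (_ : ~~ odd j = odd i) => [h|]; [rewrite h in h1|lia].
have /setP ee : [set v i; v i.+1] = [set v j; v j.+1] by rewrite -!(ev W) eij.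
have := ee (v j); rewrite !inE eqxx orTb => /orP[/eqP h|/eqP h].
  by apply: (no_even_repeat ends2 MW hij o).
by apply: (@vI i.+1 j) => //; have := odd_gt0; lia.
Qed.

Lemma e_inj i j : i < L -> j < L -> e i = e j -> i = j.
Proof.
move=> hi hj eij; case: (ltngtP i j) => // lt; exfalso.
  by apply: (@e_neq i j); rewrite ?lt.
by apply: (@e_neq j i); rewrite ?lt.
Qed.

Lemma wpart_le1 b i : wpart L e b i <= 1.
Proof.
rewrite leqNgt; apply/negP => h.
have /partP[k [+ ok ek]] : 0 < wpart L e b i by lia.
rewrite mem_iota add0n => /andP[_ kL]; move: h.
rewrite /wpart /part mnm_sumE -big_filter (bigD1_seq k) ?filter_uniq ?iota_uniq //=; last first.
  by rewrite mem_filter ok eqxx mem_iota.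
rewrite mnm1E ek eqxx big_seq_cond big1 // => j; rewrite mem_filter mem_iota => /andP[/and3P[_ _ jL] ne].
rewrite mnm1E; apply/eqP; rewrite eqb0; apply: contra ne => /eqP ej.
by apply/eqP/e_inj => //; rewrite ej.
Qed.

Lemma wpart_le N b : (forall k, k < L -> odd k = b -> 0 < N (e k)) -> (wpart L e b <= N)%MM.
Proof.
move=> h; apply/mnm_lepP => i; have := wpart_le1 b i.
case: (posnP (wpart L e b i)) => [->//|/partP[k [+ ok <-]]]; rewrite mem_iota => /= kL le1.
exact: leq_trans le1 (h k kL ok).
Qed.

Lemma adeg_walk N x : (forall i, 0 < N i -> exists2 k, k < L & i = e k) ->
  adeg ends N x = \sum_(k <- iota 0 L) (x == v k) * N (e k) + \sum_(k <- iota 0 L) (x == v k.+1) * N (e k).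
Proof.
move=> hN; rewrite -big_split /=.
transitivity (\sum_(k <- iota 0 L) (x \in ends (e k)) * N (e k)); last first.
  by apply: eq_bigr => k _; rewrite (mem_ends ends2 _ (ev W k)) mulnDl.
rewrite -(big_map e xpredT (fun i => (x \in ends i) * N i)) big_uniq /=; last first.
  by rewrite map_inj_in_uniq ?iota_uniq // => i j; rewrite !mem_iota => hi hj; apply: e_inj.
rewrite /adeg big_mkcond [RHS]big_mkcond; apply: eq_bigr => i _.
case: (boolP (i \in map e _)) => [_|ni]; first by case: ifP; rewrite ?mul1n.
case: ifP => // _; apply/eqP; rewrite -leqn0 leqNgt; apply/negP => /hN[k kL ei].
by move/negP: ni; apply; apply/mapP; exists k; rewrite // mem_iota.
Qed.

End Simple.

Section Eight.
Hypothesis sharp : cond_sharp ends.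
Variable b : nat.
Hypotheses (ltb : 0 < b < L) (ob : odd b) (vb : v 0 = v b).

Let simple1 p q : 0 < p -> p < q -> q < b ->
  ~ (odd (q - p) /\ v p = v q \/ ~~ odd (q - p) /\ adj (v p) (v q)).
Proof. exact: (lobe_simple ends2 MW ltb ob vb sharp). Qed.

Let simple2 p q : b < p -> p < q -> q < L ->
  ~ (odd (q - p) /\ v p = v q \/ ~~ odd (q - p) /\ adj (v p) (v q)).
Proof.
move=> bp pq qL; have [MW' _] := minwalk_shift b MW.
have := lobe_simple ends2 MW' (b := L - b) _ _ _ sharp (p := p - b) (q := q - b).
rewrite /= addn0 !subnKC; try lia.
rewrite (_ : q - b - (p - b) = q - p); last by lia.
have := evenL W; move=> oL; apply; try lia.
by rewrite (vL0 W).
Qed.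

Lemma eight_vertices i j : i < j < L -> v i = v j -> i = 0 /\ j = b.
Proof.
move=> hij eij.
have o : odd (j - i) by apply/negPn/negP => o; apply: (no_even_repeat ends2 MW hij o).
have ne p q : v p = v q -> p < q < L -> ~~ odd (q - p) -> False.
  by move=> h1 h2 h3; apply: (no_even_repeat ends2 MW h2 h3).
have [i0|i_gt0] := posnP i.
  split=> //; case: (ltngtP j b) => // lt; exfalso.
    by apply: (ne j b); rewrite -?vb -?eij ?i0 //; lia.
  by apply: (ne b j); rewrite -?vb -?eij ?i0 //; lia.
exfalso; case: (ltngtP j b) => [ltjb|ltbj|jb].
- by apply: (@simple1 i j) => //; [lia|left].
- case: (ltngtP i b) => [ltib|ltbi|ib].
  + by case: (lobes_separated ends2 MW ltb ob vb (p := i) (q := j) ltac:(lia) ltac:(lia)).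
  + by apply: (@simple2 i j) => //; [lia|lia|left].
  + by apply: (ne 0 j); rewrite ?vb -?ib //; lia.
- by apply: (ne 0 i); rewrite ?vb -?jb //; lia.
Qed.

(** An edge at [v 0] can be read from position [0] or [b], one of which is at odd distance. Any
    other edge at even distance lies within a lobe or between the lobes, which is excluded. *)
Lemma eight_edges f i j : i < j < L -> ends f = [set v i; v j] -> exists2 k, k < L & f = e k.
Proof.
move=> hij ef.
have oddcase p q : p < q < L -> odd (q - p) -> ends f = [set v p; v q] -> exists2 k, k < L & f = e k.
  move=> hpq o ef'; case: (no_even_chord ends2 MW hpq o ef') => [eq|[p0 qL]].
    by exists p; [lia|apply: (eq_e ends_inj MW); rewrite -eq].
  exists q; first lia.
  by apply: (eq_e ends_inj MW); rewrite qL (vL0 W) -p0 setUC.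
case: (boolP (odd (j - i))) => o; first exact: (oddcase i j).
have aij : adj (v i) (v j) by apply/existsP; exists f; rewrite ef.
have [i0|i_gt0] := posnP i.
  case: (ltngtP j b) => [ltjb|ltbj|jb].
  - by apply: (oddcase j b); rewrite ?ef -?vb ?i0 1?setUC //; lia.
  - by apply: (oddcase b j); rewrite ?ef -?vb ?i0 //; lia.
  - by move: ob o; rewrite i0 jb; lia.
case: (ltngtP j b) => [ltjb|ltbj|jb].
- by case: (@simple1 i j) => //; [lia|right].
- case: (ltngtP i b) => [ltib|ltbi|ib].
  + have [_ /negP//] := lobes_separated ends2 MW ltb ob vb (p := i) (q := j) ltac:(lia) ltac:(lia).
  + by case: (@simple2 i j) => //; [lia|lia|right].
  + by apply: (oddcase 0 j); rewrite ?vb -?ib ?ef //; lia.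
- by apply: (oddcase 0 i); rewrite ?vb -?jb ?ef 1?setUC //; lia.
Qed.

Let vI i j : 0 < i < j -> j < L -> v i <> v j.
Proof. by move=> hij jL /eight_vertices[]; lia. Qed.

Lemma eight_adeg N : (forall i, 0 < N i -> exists2 k, k < L & i = e k) ->
  (forall k, k.+1 < L -> k.+1 != b -> adeg ends N (v k.+1) = N (e k) + N (e k.+1)) /\
  adeg ends N (v 0) = N (e 0) + N (e b.-1) + N (e b) + N (e L.-1).
Proof.
move=> hN.
have eqv i j : i < j -> j < L -> (v i == v j) = (i == 0) && (j == b).
  move=> h1 h2; apply/eqP/andP => [/eight_vertices[|-> ->]//|[/eqP-> /eqP->]//]; lia.
have s1 (F : nat -> nat) k : k < L -> (forall j, j < L -> j != k -> F j = 0) -> \sum_(j <- iota 0 L) F j = F k.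
  move=> kL F0; rewrite (bigD1_seq k) ?iota_uniq ?mem_iota //= big_seq_cond big1 ?addn0 //.
  by move=> j; rewrite mem_iota => /andP[jL]; apply: F0.
have s2 (F : nat -> nat) k l : k < l -> l < L -> (forall j, j < L -> j != k -> j != l -> F j = 0) ->
    \sum_(j <- iota 0 L) F j = F k + F l.
  move=> kl lL F0; rewrite (bigD1_seq k) ?iota_uniq ?mem_iota //=; last by lia.
  rewrite -big_filter (bigD1_seq l) ?filter_uniq ?iota_uniq ?mem_filter ?mem_iota //=; last by lia.
  rewrite big_seq_cond big1 ?addn0 //.
  by move=> j; rewrite mem_filter mem_iota => /andP[/and3P[h1 _ h2] h3]; apply: F0.
split=> [k kL kb|]; rewrite (adeg_walk vI _ hN).
  rewrite (s1 _ k.+1) // ?(s1 _ k); [|lia| |].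
  - by rewrite !eqxx !mul1n addnC.
  - move=> j jL jk; have [->|nj] := eqVneq j.+1 L.
      by rewrite (vL0 W) eq_sym eqv // (negbTE kb) andbF.
    by case: (ltngtP k j) => lt; [|rewrite eq_sym|lia]; rewrite eqv //; lia.
  - move=> j jL jk; case: (ltngtP k.+1 j) => lt; [|rewrite eq_sym|lia]; rewrite eqv //; lia.
rewrite (s2 _ 0 b) ?(s2 _ b.-1 L.-1); try lia.
- rewrite (_ : b.-1.+1 = b); last by lia.
  rewrite (_ : L.-1.+1 = L); last by lia.
  by rewrite (vL0 W) -vb !eqxx; lia.
- move=> j jL j1 j2; rewrite eqv //; lia.
- move=> j jL j1 j2; rewrite eqv //; lia.
Qed.

(* The integral relations between the degrees of the edges of the two cycles are
   the multiples of the alternating one. *)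
Lemma eight_above N R : eqdeg N R -> N <> R ->
  (forall x, 0 < adeg ends N x -> exists k, x = v k) ->
  (wpart L e false <= N)%MM \/ (wpart L e true <= N)%MM.
Proof.
move=> dNR neNR hN.
have L0 := L_gt0 W.
have hedge Q i : (forall x, 0 < adeg ends Q x -> exists k, x = v k) ->
    0 < Q i -> exists2 k, k < L & i = e k.
  move=> hQ Qi; have [x [y [exy ei]]] : exists x y, x != y /\ ends i = [set x; y].
    by have /eqP/cards2P[x [y [ne ->]]] := ends2 i; exists x, y.
  have vert z : z \in ends i -> exists2 k, k < L & z = v k.
    move=> zi; have [|k ->] := hQ z; first by apply: leq_trans Qi (leq_adeg _ zi).
    by exists (k %% L); rewrite ?ltn_mod //; case: (cwalk_mod k W).
  have [|k kL ex] := vert x; first by rewrite ei set21.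
  have [|l lL ey] := vert y; first by rewrite ei set22.
  case: (ltngtP k l) => lt.
  - by apply: (eight_edges (i := k) (j := l)); rewrite ?lt // ei ex ey.
  - by apply: (eight_edges (i := l) (j := k)); rewrite ?lt // ei ex ey setUC.
  - by move: exy; rewrite ex ey lt eqxx.
have eN i := hedge N i hN.
have eR i : 0 < R i -> exists2 k, k < L & i = e k.
  by apply: hedge => x; rewrite -(eqdegP _ _ _ dNR); apply: hN.
have [aN aN0] := eight_adeg eN; have [aR aR0] := eight_adeg eR.
pose z k : int := ((N (e k))%:Z - (R (e k))%:Z)%R.
have zS k : k.+1 < L -> k.+1 != b -> z k.+1 = (- z k)%R.
  move=> h1 h2; have := aN k h1 h2; rewrite (eqdegP _ _ _ dNR) aR // /z; lia.
have z1 k : k < b -> z k = (sg (odd k) * z 0)%R.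
  elim: k => [|k IH] kb; first by rewrite mul1r.
  by rewrite zS ?IH; [|lia..]; rewrite /sg /=; case: (odd k) => /=; lia.
have z2 k : b + k < L -> z (b + k) = (sg (odd k) * z b)%R.
  elim: k => [|k IH] kb; first by rewrite addn0 mul1r.
  by rewrite addnS zS ?IH; [|lia..]; rewrite /sg /=; case: (odd k) => /=; lia.
(* Since the cycles are odd, the two edges of each of them at the repeated vertex carry the same
   value, and the relation there reads [2 z 0 + 2 z b = 0]. *)
have zb : z b = (- z 0)%R.
  have := z1 b.-1 ltac:(lia); have := z2 (L.-1 - b) ltac:(lia).
  rewrite subnKC; last by lia.
  have -> : odd b.-1 = false by lia.
  have -> : odd (L.-1 - b) = false by have := evenL W; lia.
  have := aN0; rewrite (eqdegP _ _ _ dNR) aR0 /sg !mul1r /z; move: (N (e 0)) (N (e b.-1)) (N (e b)) (N (e L.-1)) (R (e 0)) (R (e b.-1)) (R (e b)) (R (e L.-1)); clear; lia.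
have zk k : k < L -> z k = (sg (odd k) * z 0)%R.
  move=> kL; have [|le] := ltnP k b; first exact: z1.
  rewrite -(subnKC le) z2 ?subnKC // zb.
  have -> : odd k = ~~ odd (k - b) by lia.
  by rewrite /sg; case: (odd _) => /=; lia.
(* When [z 0] is nonzero, [z] is positive at all positions of one parity, and the corresponding half
   divides [N]. *)
case: (ltrgt0P (z 0)) => z0.
- left; apply: (wpart_le vI) => k kL ok.
  by have := zk k kL; rewrite ok /sg ?mul1r ?mulN1r; move: z0; rewrite /z; move: (N (e k)) (R (e k)) (N (e 0)) (R (e 0)); clear; lia.
- right; apply: (wpart_le vI) => k kL ok.
  by have := zk k kL; rewrite ok /sg ?mul1r ?mulN1r; move: z0; rewrite /z; move: (N (e k)) (R (e k)) (N (e 0)) (R (e 0)); clear; lia.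
- case: neNR; apply/mnmP => i.
  have NRe k : k < L -> N (e k) = R (e k) by move=> kL; have := zk k kL; rewrite z0 /z; lia.
  case: (posnP (N i)) => [N0|/eN[k kL ->]]; last exact: NRe.
  case: (posnP (R i)) => [R0|/eR[k kL ->]]; last exact: NRe.
  by rewrite N0 R0.
Qed.

End Eight.
End Fix.

(** A repeated vertex is rotated to position 0. This may exchange the halves, in which the
    conclusion is symmetric. *)
Lemma minwalk_cases L e v c : cond_sharp ends -> minwalk L e v c ->
  (forall b i, wpart L e b i <= 1) /\
  ((forall i j, i < j < L -> v i <> v j) \/
   forall N R, eqdeg N R -> N <> R -> (forall x, 0 < adeg ends N x -> exists k, x = v k) ->
     (wpart L e false <= N)%MM \/ (wpart L e true <= N)%MM).
Proof.
move=> sharp MW.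
have [[i [j [hij eij]]]|no] := classic (exists i j, i < j < L /\ v i = v j).
  have o : odd (j - i) by apply/negPn/negP => o; apply: (no_even_repeat ends2 MW hij o).
  have [MW' ew] := minwalk_shift i MW.
  have h0 : 0 < j - i < L by lia.
  have hv : (v \o addn i) 0 = (v \o addn i) (j - i) by rewrite /= addn0 subnKC //; lia.
  have vI p q : 0 < p < q -> q < L -> (v \o addn i) p <> (v \o addn i) q.
    by move=> h1 h2 /(eight_vertices MW' sharp h0 o hv)[]; lia.
  split.
    move=> b k; have := wpart_le1 MW' vI (odd i (+) b) k.
    by rewrite ew addbA addbb.
  right=> N R dNR neq hN.
  have [W _ _] := MW.
  have vLk s k : v (k + L * s) = v k.
    by elim: s => [|s IH]; rewrite ?muln0 ?addn0 // mulnS [L + _]addnC addnA (vL W).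
  have {}hN x : 0 < adeg ends N x -> exists k, x = (v \o addn i) k.
    (* [L * i - i] is a nonnegative shift that undoes the rotation by [i] modulo [L]. *)
    move=> /hN[k ->]; exists (k + (L * i - i)) => /=.
    rewrite -(vLk i); congr v; have := L_gt0 W; have : i <= L * i by rewrite leq_pmull // (L_gt0 W).
    lia.
  have := eight_above MW' sharp h0 o hv dNR neq hN; rewrite !ew.
  by case: (odd i); rewrite /= ?addbF ?addbT /=; tauto.
have vI i j : i < j < L -> v i <> v j by move=> hij eij; apply: no; exists i, j.
split; last by left.
by apply: (wpart_le1 MW) => i j h1 h2; apply: vI; lia.
Qed.

End FigureEight.

(** * Crossing chords in an even cycle *)

Section Crossing.
Variables (n m : nat) (ends : 'I_m -> {set 'I_n}).
Hypothesis ends2 : forall i, #|ends i| = 2.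
Hypothesis ends_inj : injective ends.
Implicit Types (M N R : 'X_{1..m}) (x : 'I_n).
Local Notation minmov := (minmov ends).
Local Notation eqdeg := (eqdeg ends).
Local Notation minwalk := (minwalk ends).
Variables (L : nat) (e : nat -> 'I_m) (v : nat -> 'I_n) (c : bool).
Hypothesis MW : minwalk L e v c.
Hypothesis vI : forall i j, i < j < L -> v i <> v j.
Let W : cwalk ends L e v. Proof. by case: MW. Qed.

Lemma v_inj i j : i < L -> j < L -> v i = v j -> i = j.
Proof.
move=> hi hj eij; case: (ltngtP i j) => // lt; exfalso.
  by apply: (@vI i j); rewrite ?lt.
by apply: (@vI j i); rewrite ?lt.
Qed.

(** The parities of [j - t] and [j' - t'] make both chords odd, and that of [t' - t] makes the
    crossing effective. Only the order [t < t'] is kept; the other one exchanges the chords. *)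
Definition interleaved f f' t j t' j' :=
  [/\ ends f = [set v t; v j] /\ ends f' = [set v t'; v j'],
      (forall k, e k != f) /\ (forall k, e k != f'),
      [&& t < t', t' < j, j < j' & j' < L] &
      [/\ odd (t' - t), ~~ odd (j - t) & ~~ odd (j' - t')]].

(** The arcs from [t] to [t'] and from [j] to [j'] have, up to sign, the alternating degree of the
    two chords. By minimality these arcs or the complementary ones have total length 2, and all of
    them are odd, so each is one edge. *)
Lemma interleaved_cycle4 f f' t j t' j' : interleaved f f' t j t' j' ->
  exists k k', [/\ k < k' < L, odd k = odd k' &
    cycle4 ends (e k) f (e k') f' \/ cycle4 ends (e k) f' (e k') f].
Proof.
case=> [[ef ef'] [nf nf'] /and4P[h1 h2 h3 h4] [o1 o2 o3]].
have [_ minM neq] := MW.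
have aT x : altdeg ends e (iota t (t' - t) ++ iota j (j' - j)) x =
    (sg (odd t) * ((x \in ends f)%:Z + (x \in ends f')%:Z))%R.
  rewrite altdeg_cat !(altdeg_iota ends2 (ev W)) (mem_ends ends2 _ ef) (mem_ends ends2 _ ef').
  rewrite (_ : t + (t' - t) = t'); last by lia.
  rewrite (_ : j + (j' - j) = j'); last by lia.
  have -> : odd t' = ~~ odd t by lia.
  have -> : odd j = odd t by lia.
  have -> : odd j' = ~~ odd t by lia.
  by rewrite /sg; case: (odd t); case: (_ == _); case: (_ == _); case: (_ == _); case: (_ == _).
have uq s : uniq s -> all (fun i => i < L) s -> uniq (map v s).
  by move=> us /allP sL; rewrite map_inj_in_uniq // => p q /sL hp /sL hq; apply: v_inj.
case: (two_chords_split ends2 W minM neq (@perm_2arcs L t t' j j' ltac:(lia) ltac:(lia)) nf aT) => -[_];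
  rewrite !size_cat !size_iota => sz.
- exists t', j'; split; [lia|lia|left].
  exists (v t'), (v j), (v t), (v j'); split.
  + by apply: (uq [:: t'; j; t; j']); rewrite /= ?inE; lia.
  + by rewrite (ev W); congr [set _; v _]; lia.
  + by rewrite ef setUC.
  + rewrite (ev W) setUC; congr [set _; _]; rewrite (_ : j'.+1 = L); last by lia.
    by rewrite (vL0 W); congr v; lia.
  + by rewrite ef' setUC.
- exists t, j; split; [lia|lia|right].
  exists (v t), (v t'), (v j'), (v j); split => //.
  + by apply: (uq [:: t; t'; j'; j]); rewrite /= ?inE; lia.
  + by rewrite (ev W); congr [set _; v _]; lia.
  + by rewrite (ev W) setUC; congr [set v _; _]; lia.
  + by rewrite ef setUC.
Qed.

Lemma at_v k l : k < L -> l < L -> v l \in ends (e k) -> [\/ k = l, k.+1 = l | k.+1 = L /\ l = 0].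
Proof.
move=> kL lL; rewrite (ev W) !inE => /orP[/eqP/(v_inj lL kL)->|/eqP]; first by constructor 1.
have [kL1|] := eqVneq k.+1 L.
  by rewrite kL1 (vL0 W) => /(v_inj lL (L_gt0 W)); constructor 3.
by move=> ne /v_inj h; constructor 2; rewrite h //; lia.
Qed.

(** Edges at positions of equal parity do not meet on an even cycle, so each half is a matching. *)
Lemma adeg_wpart_le1 b x : adeg ends (wpart L e b) x <= 1.
Proof.
rewrite leqNgt; apply/negP => h.
have vI' i j : 0 < i < j -> j < L -> v i <> v j by move=> *; apply: vI; lia.
have le1 := wpart_le1 ends2 MW vI' b.
have [i xi wi] : exists2 i, x \in ends i & 0 < wpart L e b i by apply: adeg_gt0; lia.
have [i' xi' [ne wi']] : exists2 i', x \in ends i' & i' != i /\ 0 < wpart L e b i'.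
  apply: NNPP => no; move: h; rewrite /adeg (bigD1 i) //= big1 ?addn0 ?ltnNge ?le1 // => i' /andP[xi' ne].
  by apply/eqP; rewrite -leqn0 leqNgt; apply/negP => wi'; apply: no; exists i'.
have /partP[k [+ ok ek]] := wi; have /partP[k' [+ ok' ek']] := wi'; rewrite !mem_iota => /= k'L kL.
move: xi xi' ne; rewrite -ek -ek' (ev W) !inE => /orP[]/eqP ex.
  have := @at_v k' k k'L kL; rewrite ex => H /(H)[->|e1|[e1 e2]]; first by rewrite eqxx.
    by lia.
  by have := evenL W; lia.
have [kk|kk] := eqVneq k.+1 L.
  have oL := evenL W; rewrite ex kk (vL0 W) => H.
  have [e1|e1|[e1 _]] := @at_v k' 0 k'L (L_gt0 W) H; [lia|lia|].
  by rewrite (_ : k = k') ?eqxx //; lia.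
rewrite ex => H; have [e1|e1|[e1 e2]] := @at_v k' k.+1 k'L ltac:(lia) H; [lia| |lia].
by rewrite (_ : k = k') ?eqxx //; lia.
Qed.

(** * Two disjoint matchings of the same vertices of the cycle *)

Section Matching.
Variables N R : 'X_{1..m}.
Hypotheses (leN : (N <= wpart L e (~~ c))%MM) (dNR : eqdeg N R).
Hypothesis disj : forall i, 0 < N i -> R i = 0.

(** As [N] and [R] have equal degrees, this also says that [R] covers [v l]. *)
Let X l := 0 < adeg ends N (v l).

Let XR g l : v l \in ends g -> 0 < R g -> X l.
Proof.
by move=> h Rg; rewrite /X (eqdegP _ _ _ dNR); apply: leq_trans Rg (leq_adeg _ h).
Qed.

Let vertR g x : 0 < R g -> x \in ends g -> exists2 l, l < L & x = v l.
Proof.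
move=> Rg xg; have : 0 < adeg ends N x by rewrite (eqdegP _ _ _ dNR); apply: leq_trans Rg (leq_adeg _ xg).
case/adeg_gt0 => i xi Ni; have /partP[k [+ _ ek]] : 0 < wpart L e (~~ c) i.
  by apply: leq_trans Ni _; apply/mnm_lepP.
rewrite mem_iota /= => kL; move: xi; rewrite -ek (ev W) !inE => /orP[]/eqP->; first by exists k.
have [->|ne] := eqVneq k.+1 L; last by exists k.+1 => //; lia.
by exists 0; [exact: L_gt0 W|exact: vL0 W].
Qed.

(** Each vertex of the cycle lies on just one edge of parity [~~ c], and [N] consists of such
    edges. *)
Let XN k : k < L -> odd k = ~~ c -> X k \/ (k.+1 < L /\ X k.+1) -> 0 < N (e k).
Proof.
move=> kL ok hX.
have [l [lL vl Xl nl]] : exists l, [/\ l < L, l = k \/ l = k.+1, X l & True].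
  by case: hX => [h|[h1 h2]]; [exists k|exists k.+1]; split=> //; [left|right].
have [i xi Ni] := adeg_gt0 Xl.
have /partP[k' [+ ok' ek]] : 0 < wpart L e (~~ c) i by apply: leq_trans Ni _; apply/mnm_lepP.
rewrite mem_iota /= => k'L; rewrite -ek in xi Ni.
suff <- : k' = k by [].
by have := evenL W; case: (at_v k'L lL xi) vl => [|h|[h h']] + []; lia.
Qed.

Let NX k : 0 < N (e k) -> X k /\ X k.+1.
Proof.
by move=> Nk; split; apply: leq_trans Nk (leq_adeg _ _); rewrite (ev W) ?set21 ?set22.
Qed.

Let R_uniq g g' x : 0 < R g -> 0 < R g' -> x \in ends g -> x \in ends g' -> g = g'.
Proof.
move=> Rg Rg' xg xg'; apply/eqP/negPn/negP => ne.
have : adeg ends R x <= 1.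
  by rewrite -(eqdegP _ _ _ dNR); apply: leq_trans (adeg_wpart_le1 (~~ c) x); apply: adeg_le.
by rewrite /adeg (bigD1 g) //= (bigD1 g') /= ?xg' 1?eq_sym //; lia.
Qed.

Definition chord_of f t j := [/\ 0 < R f, forall k, e k != f, t < j < L & ends f = [set v t; v j]].

Lemma chord_even f t j : chord_of f t j -> ~~ odd (j - t).
Proof.
case=> Rf nf htj ef; apply/negP => o.
case: (no_even_chord ends2 MW htj o ef) => [jt|[t0 jL]].
  have /eqP[] := nf t; apply/esym/(eq_e ends_inj MW); by rewrite ef jt.
have /eqP[] := nf j; apply/esym/(eq_e ends_inj MW).
by rewrite ef t0 jL (vL0 W) setUC.
Qed.

Lemma R_edge g l : 0 < R g -> v l \in ends g -> l < L ->
  (exists2 k, k < L & g = e k) \/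
  exists2 l', l' != l & chord_of g (minn l l') (maxn l l').
Proof.
move=> Rg lg lL.
have [|ng] := classic (exists2 k, k < L & g = e k); [by left|right].
have [y ey] : exists y, ends g = [set v l; y].
  have /eqP/cards2P[y [z [_ eg]]] := ends2 g.
  by move: lg; rewrite eg !inE => /orP[/eqP->|/eqP->]; [exists z|exists y; rewrite setUC].
have [l' l'L ey'] := vertR (x := y) Rg ltac:(by rewrite ey set22).
have ne : l' != l.
  by apply/eqP => e'; have := ends_neq ends2 ey; rewrite ey' e' eqxx.
exists l' => //; split=> //.
- move=> k; apply/eqP => ek; apply: ng; exists (k %% L); first by rewrite ltn_mod (L_gt0 W).
  by have [_ ->] := cwalk_mod k W.
- by case: (ltngtP l l') ne => //; lia.
- rewrite ey ey'; case: (ltngtP l l') ne => // lt _; first by rewrite setUC.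
Qed.

(* Inside a shortest uncrossed chord, [N]- and [R]-edges would have to alternate
   along the cycle up to the other end of the chord. *)
Lemma chord_crosses f t j : chord_of f t j ->
  exists f1 f2 t1 j1 t2 j2, [/\ 0 < R f1, 0 < R f2 & interleaved f1 f2 t1 j1 t2 j2].
Proof.
have [k] := ubnP (j - t); elim: k f t j => // k IH f t j ltk ch.
have otj := chord_even ch; have [Rf nf htj ef] := ch.
apply: NNPP => no.
(* Otherwise [R] covers [v r] by a chord: with its other end outside [[t, j]] it crosses [f], and
   inside it is shorter than [f]. *)
have step r : t < r < j -> odd (r - t) -> X r -> 0 < R (e r) \/ 0 < R (e r.-1).
  move=> hr orr Xr.
  have [g rg Rg] : exists2 g, v r \in ends g & 0 < R g.
    by apply: adeg_gt0; rewrite -(eqdegP _ _ _ dNR).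
  case: (R_edge Rg rg ltac:(lia)) => [[k' k'L eg]|[l' ne cg]].
    rewrite eg in rg Rg; have [|h|[_ h]] := at_v k'L (l := r) ltac:(lia) rg; last by lia.
      by move=> <-; left.
    by right; rewrite -h.
  exfalso; have og := chord_even cg; have [_ ng hg eg] := cg.
  have [ltl|gel] := ltnP l' t.
    apply: no; exists g, f, l', r, t, j; split=> //; split=> //; last by split; lia.
      by split; rewrite ?ef // eg /minn /maxn; case: ifP; lia || by rewrite setUC.
    by lia.
  have [gtl|lel] := ltnP j l'.
    apply: no; exists f, g, t, j, r, l'; split=> //; split=> //; last by split; lia.
      by split; rewrite ?ef // eg /minn /maxn; case: ifP; lia || by [].
    by lia.
  by apply: no; apply: (IH g (minn r l') (maxn r l')) => //; lia.
have tj2 : t.+2 <= j by lia.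
have vtf : v t \in ends f by rewrite ef set21.
have vjf : v j \in ends f by rewrite ef set22.
(* [N] uses positions of parity [~~ c], so it contains [e t] or [e j.-1] according to the parity of
   [t]. The alternation is propagated from that end until an edge of [R] meets [f], although [R] has
   one edge at each vertex. *)
case: (eqVneq (odd t) (~~ c)) => [tc|/eqP tc].
- have all i : t.+1 + 2 * i < j -> X (t.+1 + 2 * i).
    elim: i => [|i IHi] hi.
      rewrite muln0 addn0; apply: (proj2 (NX _)); apply: XN => //; first lia.
      by left; apply: XR vtf Rf.
    set r := t.+1 + 2 * i in IHi.
    have Xr : X r by apply: IHi; lia.
    have [Rr|Rr] := step r ltac:(lia) ltac:(lia) Xr; last first.
      have N1 : 0 < N (e r.-1).
        apply: XN; [lia|rewrite /r -tc; lia|right].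
        by rewrite (_ : r.-1.+1 = r); [split => //; lia|lia].
      by rewrite (disj N1) in Rr.
    have N1 : 0 < N (e r.+1).
      apply: XN; [lia|rewrite /r -tc; lia|left].
      by apply: XR Rr; rewrite (ev W) set22.
    by have [_] := NX N1; rewrite (_ : r.+2 = t.+1 + 2 * i.+1) // /r; lia.
  pose i := (j - t.+2)./2; have ei : (t.+1 + 2 * i).+1 = j by rewrite /i; lia.
  have Xr := all i ltac:(lia); set r := t.+1 + 2 * i in Xr ei.
  have [Rr|Rr] := step r ltac:(lia) ltac:(lia) Xr.
    have /eqP[] := nf r; apply: (@R_uniq _ _ (v j)) => //.
    by rewrite (ev W) ei set22.
  have N1 : 0 < N (e r.-1).
    apply: XN; [lia|rewrite /r -tc; lia|right].
    by rewrite (_ : r.-1.+1 = r); [split => //; lia|lia].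
  by rewrite (disj N1) in Rr.
- have {}tc : odd t = c by case: (odd t) tc; case: c.
  have all i : t + 2 * i < j -> X (j.-1 - 2 * i).
    elim: i => [|i IHi] hi.
      rewrite muln0 subn0; apply: (proj1 (NX _)); apply: XN; [lia|rewrite -tc; lia|right].
      rewrite (_ : j.-1.+1 = j); last by lia.
      by split; [lia|apply: XR vjf Rf].
    set r := j.-1 - 2 * i in IHi.
    have Xr : X r by apply: IHi; lia.
    have [Rr|Rr] := step r ltac:(lia) ltac:(lia) Xr.
      have N1 : 0 < N (e r) by apply: XN; [lia|rewrite /r -tc; lia|left].
      by rewrite (disj N1) in Rr.
    have N1 : 0 < N (e r.-2).
      apply: XN; [lia|rewrite /r -tc; lia|right].
      split; first by lia.
      by apply: XR Rr; rewrite (ev W) (_ : r.-2.+1 = r.-1) ?set21 //; lia.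
    by have [] := NX N1; rewrite (_ : r.-2 = j.-1 - 2 * i.+1) // /r; lia.
  pose i := (j - t.+2)./2; have ei : t.+1 = j.-1 - 2 * i by rewrite /i; lia.
  have := all i ltac:(lia); rewrite -ei => Xr.
  have [Rr|Rr] := step t.+1 ltac:(lia) ltac:(lia) Xr.
    have N1 : 0 < N (e t.+1) by apply: XN; [lia|rewrite -tc; lia|left].
    by rewrite (disj N1) in Rr.
  have /eqP[] := nf t; apply: (@R_uniq _ _ (v t)) => //.
  by rewrite (ev W) set21.
Qed.

End Matching.

(** If [R] had only edges of the cycle, then, being disjoint from [N], it would divide [wpart L e c]
    and by minimality equal it. So [R] contains a chord. *)
Lemma matching_crosses N R : (N <= wpart L e (~~ c))%MM -> eqdeg N R ->
  (forall i, 0 < N i -> R i = 0) -> N <> 0%MM -> R <> wpart L e c ->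
  exists f1 f2 t1 j1 t2 j2, [/\ 0 < R f1, 0 < R f2 & interleaved f1 f2 t1 j1 t2 j2].
Proof.
move=> leN dNR disj N0 neR.
have [_ [_ minM] _] := MW.
have [[f [Rf nf]]|all] := classic (exists f, 0 < R f /\ forall k, e k != f).
  have /card_gt0P[x xf] : 0 < #|ends f| by rewrite ends2.
  have : 0 < adeg ends N x by rewrite (eqdegP _ _ _ dNR); apply: leq_trans Rf (leq_adeg _ xf).
  case/adeg_gt0 => i xi Ni; have /partP[k [+ _ ek]] : 0 < wpart L e (~~ c) i.
    by apply: leq_trans Ni _; apply/mnm_lepP.
  rewrite mem_iota /= => kL; move: xi; rewrite -ek (ev W) => xk.
  have [l lL ex] : exists2 l, l < L & x = v l.
    move: xk; rewrite !inE => /orP[]/eqP->; first by exists k.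
    have [->|ne] := eqVneq k.+1 L; last by exists k.+1 => //; lia.
    by exists 0; [exact: L_gt0 W|exact: vL0 W].
  rewrite ex in xf; have [[k' _ ef]|[l' _ ch]] := R_edge leN dNR Rf xf lL.
    by have /eqP[] := nf k'.
  exact: (chord_crosses leN dNR disj ch).
case: neR; apply: minM.
  apply/mnm_lepP => i; case: (posnP (R i)) => [->//|Ri].
  have [k kL ek] : exists2 k, k < L & i = e k.
    apply: NNPP => h; apply: all; exists i; split=> // k; apply/eqP => ek; apply: h.
    exists (k %% L); first by rewrite ltn_mod (L_gt0 W).
    by have [_ ->] := cwalk_mod k W.
  have vk : v k \in ends i by rewrite ek (ev W) set21.
  have le1 : R i <= 1.
    apply: leq_trans (leq_adeg _ vk) _; rewrite -(eqdegP _ _ _ dNR).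
    by apply: leq_trans (adeg_wpart_le1 (~~ c) (v k)); apply: adeg_le.
  apply: leq_trans le1 _; apply/partP; exists k; rewrite mem_iota; split=> //.
  case: (eqVneq (odd k) c) => // /eqP ok; exfalso.
  have Xk : 0 < adeg ends N (v k) by rewrite (eqdegP _ _ _ dNR); apply: leq_trans Ri (leq_adeg _ vk).
  have [i' xi' Ni'] := adeg_gt0 Xk.
  have /partP[k' [+ ok' ek']] : 0 < wpart L e (~~ c) i' by apply: leq_trans Ni' _; apply/mnm_lepP.
  rewrite mem_iota /= => k'L; rewrite -ek' in xi' Ni'.
  have ekk : k' = k.
    have := evenL W; have {}ok : odd k = ~~ c by case: (odd k) ok; case: c.
    by case: (at_v k'L kL xi') => [//|h|[h h']]; lia.
  by move: Ri; rewrite ek -ekk (disj _ Ni').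
exists N; last by rewrite eqdegC.
apply/eqP => eN; apply: N0; apply/mnmP => i; rewrite mnm0E; apply/eqP.
by rewrite -leqn0 leqNgt; apply/negP => Ni; have := disj i Ni; rewrite -eN; lia.
Qed.

End Crossing.

(** * Decomposition into closed walks *)

Section WalkDecomposition.
Variables (n m : nat) (ends : 'I_m -> {set 'I_n}).
Hypothesis ends2 : forall i, #|ends i| = 2.
Implicit Types (M N R : 'X_{1..m}) (x : 'I_n) (c : bool).
Local Notation eqdeg := (eqdeg ends).

Lemma adeg_lt_ex N R x : adeg ends N x < adeg ends R x -> exists2 i, x \in ends i & N i < R i.
Proof.
move=> lt; apply: NNPP => h; move: lt; rewrite ltnNge => /negP; apply.
apply: leq_sum => i xi; rewrite leqNgt; apply/negP => lti; apply: h; by exists i.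
Qed.

Lemma mem_ends_pair i x : x \in ends i -> exists y, ends i = [set x; y].
Proof.
have /eqP/cards2P[y [z [_ ->]]] := ends2 i.
by rewrite !inE => /orP[/eqP->|/eqP->]; [exists z|exists y; rewrite setUC].
Qed.

Section Trail.
Variables N R : 'X_{1..m}.
Hypotheses (dNR : eqdeg N R) (N0 : N != 0%MM).

Definition trail k (e : nat -> 'I_m) (v : nat -> 'I_n) :=
  [/\ forall i, i < k -> ends (e i) = [set v i; v i.+1],
      (part e (iota 0 k) false <= N)%MM, (part e (iota 0 k) true <= R)%MM
    & 0 < adeg ends N (v 0)].

Lemma trail_altdeg k e v x : (forall i, i < k -> ends (e i) = [set v i; v i.+1]) ->
  altdeg ends e (iota 0 k) x = ((x == v 0)%:Z - sg (odd k) * (x == v k)%:Z)%R.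
Proof.
elim: k => [|k IH] ev; first by rewrite /altdeg big_nil mul1r subrr.
rewrite -addn1 iotaD altdeg_cat IH => [|i ik]; last by apply: ev; lia.
rewrite add0n /altdeg big_seq1 (mem_ends ends2 _ (ev k _)) ?addn1 //= /sg.
by case: (odd k); rewrite /=; case: (_ == _); case: (_ == _); case: (_ == _).
Qed.

(* At the end of a trail that has not closed up, one colour has been used once
   more than the other, while [N] and [R] have the same degree there. *)
Lemma trail_extend k e v : trail k e v -> (k = 0 \/ odd k \/ v k <> v 0) ->
  exists e' v', trail k.+1 e' v'.
Proof.
case=> ev leN leR x0 hk.
pose b := odd k; pose Q c := if c then R else N.
have leQ c : (part e (iota 0 k) c <= Q c)%MM by case: c.
have [i vi lti] : exists2 i, v k \in ends i & part e (iota 0 k) b i < Q b i.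
  apply: adeg_lt_ex.
  have := trail_altdeg (v k) ev; rewrite altdegE eqxx /b.
  have := adeg_le ends (v k) leN; have := adeg_le ends (v k) leR.
  have := eqdegP _ _ _ dNR (v k); rewrite /sg /Q.
  case: hk => [k0|[ok|nk]].
  - by move=> *; rewrite k0 /part big_nil adeg0; exact: x0.
  - by rewrite ok; case: (_ == _); lia.
  - case: (odd k); rewrite ?mulN1r ?mul1r; first by case: (_ == _); lia.
    have -> : (v k == v 0) = false by apply/eqP.
    lia.
have [y ey] := mem_ends_pair vi.
pose e' j := if j == k then i else e j; pose v' j := if j == k.+1 then y else v j.
have pe c : part e' (iota 0 k) c = part e (iota 0 k) c.
  rewrite /part [LHS]big_seq_cond [RHS]big_seq_cond; apply: eq_bigr => j; rewrite mem_iota => /andP[/andP[_ hj] _].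
  by rewrite /e' ltn_eqF.
have pS c : part e' (iota 0 k.+1) c = (part e (iota 0 k) c + (if odd k == c then U_(i) else 0))%MM.
  rewrite -addn1 iotaD part_cat pe /part big_cons big_nil add0n /e' eqxx.
  by case: ifP => _; rewrite ?addm0.
have leS c : (part e' (iota 0 k.+1) c <= Q c)%MM.
  rewrite pS; case: eqP => [<-|_]; last by rewrite addm0.
  apply/mnm_lepP => j; rewrite mnmDE mnm1E; have /mnm_lepP/(_ j) := leQ b.
  case: eqP => [<-|_] h; last by rewrite addn0.
  by rewrite addn1.
exists e', v'; split; [|exact: (leS false)|exact: (leS true)|by []].
move=> j; rewrite ltnS leq_eqVlt /e' /v' => /orP[/eqP->|ltj].
  by rewrite !eqxx ltn_eqF.
by rewrite !ltn_eqF ?ev ?ltnS //; exact: ltnW.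
Qed.

(** A trail is no longer than the sum of the degrees of [N] and [R], so some trail returns to its
    start after an even number of steps. *)
Lemma walk_extract : exists L e v,
  [/\ cwalk ends L e v, (wpart L e false <= N)%MM & (wpart L e true <= R)%MM].
Proof.
have [k [e [v [[ev leN leR x0] [k0 [ok vk]]]]]] :
    exists k e v, trail k e v /\ 0 < k /\ ~~ odd k /\ v k = v 0.
  apply: NNPP => h.
  have all k : exists e v, trail k e v.
    elim: k => [|k [e [v t]]].
      have [i Ni] : exists i, 0 < N i.
        apply: NNPP => h'; move/negP: N0; apply; apply/eqP/mnmP => i; rewrite mnm0E.
        by apply/eqP; rewrite -leqn0 leqNgt; apply/negP => hi; apply: h'; exists i.
      have /card_gt0P[x xi] : 0 < #|ends i| by rewrite ends2.
      exists (fun=> i), (fun=> x); split => //.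
      + by rewrite /part big_nil; apply/mnm_lepP => j; rewrite mnm0E.
      + by rewrite /part big_nil; apply/mnm_lepP => j; rewrite mnm0E.
      + exact: leq_trans Ni (leq_adeg _ xi).
    apply: (trail_extend t); have [->|k0] := posnP k; first by left.
    right; case: (boolP (odd k)) => ok; [by left|right => vk].
    by apply: h; exists k, e, v.
  have [e [v [_ lN lR _]]] := all (mdeg N + mdeg R).+1.
  have := size_part e (iota 0 (mdeg N + mdeg R).+1) false.
  rewrite size_iota -[~~ false]/true; have := le_mdeg lN; have := le_mdeg lR; lia.
exists k, (fun i => e (i %% k)), (fun i => v (i %% k)).
have pE c : wpart k (fun i => e (i %% k)) c = part e (iota 0 k) c.
  rewrite /wpart /part [LHS]big_seq_cond [RHS]big_seq_cond; apply: eq_bigr => j; rewrite mem_iota => /andP[/andP[_ hj] _].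
  by rewrite modn_small.
rewrite !pE; split => //; split => // [i|i|i]; rewrite ?modnDr //.
have lt := ltn_pmod i k0; rewrite ev //; congr [set _; _].
have -> : i.+1 %% k = (i %% k).+1 %% k by rewrite -[i.+1]addn1 -modnDml addn1.
have [->|ne] := eqVneq (i %% k).+1 k; first by rewrite modnn vk.
by rewrite [(i %% k).+1 %% k]modn_small // ltn_neqAle ne lt.
Qed.

End Trail.

(* A walk of length greater than [2 * n] visits some vertex twice at positions
   of the same parity; the arc in between is a shorter closed walk. *)
Lemma small_pair N R : eqdeg N R -> N != 0%MM -> exists N' R',
  [/\ (N' <= N)%MM, (R' <= R)%MM, eqdeg N' R' & 0 < mdeg N' <= n].
Proof.
have [k] := ubnP (mdeg N); elim: k N R => // k IH N R ltk dNR N0.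
have [L [e [v [W lN lR]]]] := walk_extract dNR N0.
have sz := size_part e (iota 0 L) false; rewrite size_iota /= in sz.
have dW : eqdeg (wpart L e false) (wpart L e true) := wpart_eqdeg ends2 false W.
have mW := eqdeg_mdeg ends2 dW; rewrite /wpart in mW.
have L0 := L_gt0 W.
have [leL|ltL] := leqP L (2 * n).
  exists (wpart L e false), (wpart L e true); split => //; rewrite /wpart; lia.
have /injectivePn[i [j nij [eij oij]]] : ~~ injectiveb (fun k : 'I_L => (v k, odd k)).
  apply/injectiveP => /leq_card; rewrite card_prod !card_ord card_bool; lia.
wlog ltij : i j nij eij oij / i < j.
  move=> H; case: (ltngtP i j) => lt; [exact: (H i j)|apply: (H j i) => //|].
    by rewrite eq_sym.
  by case/eqP: nij; apply: val_inj.
have jL := ltn_ord j.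
pose T := iota i (j - i).
have dT : eqdeg (part e T false) (part e T true).
  apply/eqdegP => x; have := altdegE ends e T x.
  rewrite (altdeg_iota ends2 (ev W)) (_ : i + (j - i) = j); last by lia.
  by rewrite eij oij subrr; lia.
have wT c : wpart L e c = (part e T c + part e (iota 0 i ++ iota j (L - j)) c)%MM.
  by rewrite -part_cat; apply/part_perm; rewrite perm_sym; apply: perm_arc; lia.
have sT := size_part e T false; rewrite size_iota /= in sT.
have mT := eqdeg_mdeg ends2 dT.
have := congr1 (@mdeg m) (wT false); rewrite mdegD.
have sT' := size_part e (iota 0 i ++ iota j (L - j)) false; rewrite size_cat !size_iota /= in sT'.
have := congr1 (@mdeg m) (wT true); rewrite mdegD => m2 m1.
have lTN : (part e T false <= N)%MM by apply: lepm_trans lN; rewrite wT lem_addr.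
have lTR : (part e T true <= R)%MM by apply: lepm_trans lR; rewrite wT lem_addr.
have lNm := le_mdeg lN; rewrite /wpart in lNm.
have lt : mdeg (part e T false) < k.
  by move: m1 m2; rewrite /wpart => m1 m2; clear -lNm ltk sT' m1 m2 mT mW ltij jL; lia.
have ne : part e T false != 0%MM by rewrite -mdeg_eq0; clear -sT mT ltij jL; lia.
have [N' [R' [l1 l2 d b]]] := IH _ _ lt dT ne.
by exists N', R'; split=> //; [apply: lepm_trans lTN|apply: lepm_trans lTR].
Qed.

End WalkDecomposition.

(** * Indispensable monomials *)

Section Indispensable.
Variables (K : fieldType) (n m : nat) (ends : 'I_m -> {set 'I_n}).
Hypothesis ends2 : forall i, #|ends i| = 2.
Implicit Types (M N R u v w : 'X_{1..m}) (x : 'I_n) (P Q : {mpoly K[m]}).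
Local Notation eqdeg := (eqdeg ends).
Local Open Scope ring_scope.

Section Ideal.
Variable S : seq {mpoly K[m]}.

Lemma in_ideal0 : in_ideal S 0.
Proof. by exists (fun=> 0); rewrite big1 // => i _; rewrite mul0r. Qed.

Lemma in_idealD P Q : in_ideal S P -> in_ideal S Q -> in_ideal S (P + Q).
Proof.
move=> [c ->] [d ->]; exists (fun i => c i + d i).
by rewrite -big_split; apply: eq_bigr => i _; rewrite mulrDl.
Qed.

Lemma in_idealM P Q : in_ideal S Q -> in_ideal S (P * Q).
Proof.
move=> [c ->]; exists (fun i => P * c i); rewrite mulr_sumr.
by apply: eq_bigr => i _; rewrite mulrA.
Qed.

Lemma in_ideal_mem P : P \in S -> in_ideal S P.
Proof.
move=> PS; have lt : (index P S < size S)%N by rewrite index_mem.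
exists (fun i => (i == Ordinal lt)%:R); rewrite (bigD1 (Ordinal lt)) //= eqxx mul1r nth_index //.
by rewrite big1 ?addr0 // => i /negbTE->; rewrite mul0r.
Qed.

End Ideal.

Definition adegm u : 'X_{1..n} := [multinom adeg ends u x | x < n].

Lemma adegmE u x : adegm u x = adeg ends u x. Proof. exact: mnmE. Qed.

Lemma eqdeg_adegm u v : eqdeg u v = (adegm u == adegm v).
Proof.
apply/eqdegP/eqP => [h|/mnmP h x]; last by have := h x; rewrite !adegmE.
by apply/mnmP => x; rewrite !adegmE.
Qed.

Lemma toric_mapX u : toric_map ends 'X_[u] = 'X_[adegm u] :> {mpoly K[n]}.
Proof.
rewrite /toric_map /comp_mpoly mmapX /mmap1 mpolyXE_id.
transitivity (\prod_(i < m) \prod_(x | x \in ends i) ('X_x ^+ u i : {mpoly K[n]})).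
  by apply: eq_bigr => i _; rewrite tnth_mktuple prodrXl.
rewrite (exchange_big_dep xpredT) //=; apply: eq_bigr => x _.
by rewrite adegmE /adeg expr_sum.
Qed.

Lemma toric_mapB P Q : toric_map ends (P - Q) = toric_map ends P - toric_map ends Q :> {mpoly K[n]}.
Proof. exact: raddfB. Qed.

Lemma toric_mapM P Q : toric_map ends (P * Q) = toric_map ends P * toric_map ends Q :> {mpoly K[n]}.
Proof. exact: rmorphM. Qed.

Lemma toric_binomial u v : in_toric ends ('X_[u] - 'X_[v] : {mpoly K[m]}) <-> eqdeg u v.
Proof.
rewrite /in_toric toric_mapB !toric_mapX eqdeg_adegm; split=> [/eqP|/eqP->]; last by rewrite subrr.
rewrite subr_eq0 => /eqP/(congr1 (mcoeff (adegm u))).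
rewrite !mcoeffX eqxx eq_sym; case: eqP => // _ /eqP.
by rewrite oner_eq0.
Qed.

(** Each monomial of [P] shares its degree with another one, as otherwise its coefficient would
    survive in the image. Subtracting a multiple of their difference removes it without enlarging
    the support. *)
Lemma toric_span (J : {mpoly K[m]} -> Prop) :
  J 0 -> (forall P Q, J P -> J Q -> J (P + Q)) -> (forall P Q, J Q -> J (P * Q)) ->
  (forall u v, eqdeg u v -> J ('X_[u] - 'X_[v])) ->
  forall P, in_toric ends P -> J P.
Proof.
move=> J0 JD JM JX P.
have [k] := ubnP (size (msupp P)); elim: k P => // k IH P ltk tP.
have [/msuppnil0->//|/eqP ne] := eqVneq (msupp P) [::].
have [u uP] : exists u, u \in msupp P by case: (msupp P) ne => // u s _; exists u; rewrite inE eqxx.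
have [v [vP vu duv]] : exists v, [/\ v \in msupp P, v != u & eqdeg u v].
  apply: NNPP => h; move: (uP); rewrite mcoeff_msupp => /eqP; apply.
  have := congr1 (mcoeff (adegm u)) tP; rewrite mcoeff0 => <-.
  rewrite [P in toric_map _ P]mpolyE. rewrite /toric_map. rewrite (raddf_sum (comp_mpoly _)). rewrite (raddf_sum (mcoeff _)) /=.
  rewrite (bigD1_seq u) ?msupp_uniq //= big_seq_cond big1 ?addr0; last first.
    move=> v /andP[vP vu]; rewrite linearZ /= mcoeffZ -/(toric_map _ _) toric_mapX mcoeffX.
    case: eqP => [e|_]; last by rewrite mulr0.
    by case: h; exists v; split=> //; rewrite eqdeg_adegm e.
  by rewrite linearZ /= mcoeffZ -/(toric_map _ _) toric_mapX mcoeffX eqxx mulr1.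
set D : {mpoly K[m]} := 'X_[u] - 'X_[v].
have -> : P = (P@_u)%:MP * D + (P - (P@_u)%:MP * D) by rewrite addrC subrK.
apply: JD; first by apply/JM/JX.
apply: IH; last first.
  rewrite /in_toric toric_mapB tP sub0r /toric_map rmorphM /= -/(toric_map _ D).
  by have /toric_binomial -> := duv; rewrite mulr0 oppr0.
suff : (size (msupp (P - (P@_u)%:MP * D)) < size (msupp P))%N by lia.
have -> : size (msupp P) = (size (rem u (msupp P))).+1.
  by rewrite size_rem // prednK //; case: (msupp P) uP.
rewrite ltnS; apply: uniq_leq_size; first exact: msupp_uniq.
move=> w; rewrite mem_rem_uniq ?msupp_uniq // !inE !mcoeff_msupp mcoeffB mcoeffCM mcoeffB !mcoeffX.
have [->|wu] := eqVneq w u.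
  by rewrite (negbTE vu) subr0 mulr1 subrr eqxx.
have [<- _|_] := eqVneq v w; first by rewrite -mcoeff_msupp vP.
by rewrite subrr mulr0 subr0.
Qed.

(** A balanced pair of divisors of degree at most [n] is split off, and induction applies to the
    quotients. *)
Lemma in_ideal_pairs (S : seq {mpoly K[m]}) : (forall u v, eqdeg u v -> (mdeg u <= n)%N -> in_ideal S ('X_[u] - 'X_[v])) ->
  forall u v, eqdeg u v -> in_ideal S ('X_[u] - 'X_[v]).
Proof.
move=> small u v; have [k] := ubnP (mdeg u); elim: k u v => // k IH u v ltk duv.
have [u0|u0] := eqVneq u 0%MM.
  have : mdeg v = 0%N by rewrite -(eqdeg_mdeg ends2 duv) u0 mdeg0.
  by move/eqP; rewrite mdeg_eq0 u0 => /eqP->; rewrite subrr; apply: in_ideal0.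
have [u' [v' [lu lv d' /andP[gt0 len]]]] := small_pair ends2 duv u0.
have -> : 'X_[u] - 'X_[v] = 'X_[u - u'] * ('X_[u'] - 'X_[v']) + 'X_[v'] * ('X_[u - u'] - 'X_[v - v']) :> {mpoly K[m]}.
  rewrite !mulrBr -!mpolyXD submK // [(v' + (v - v'))%MM]addmC submK // [(v' + _)%MM]addmC.
  by rewrite addrA subrK.
apply: in_idealD; apply: in_idealM; first exact: small.
apply: IH; last exact: eqdegB.
by have := congr1 (@mdeg m) (submK lu); rewrite mdegD; lia.
Qed.

(** If [M] is not minimal, the toric binomials of bounded degree that avoid [M] still generate. If
    it is minimal, some generator has a movable monomial dividing [M], which must be [M]. *)
Lemma indispensable_minmov M : indispensable ends K M <-> minmov ends M.
Proof.
split=> [ind|[mM minM] S [binS genS]].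
- apply: NNPP => nM.
  (* Degrees below [D] include those up to [n], which suffice to generate, and that of [M], where
     replacements take place. *)
  pose D := (maxn n (mdeg M)).+1.
  pose T : finType := ('X_{1..m < D} * 'X_{1..m < D})%type.
  pose S := [seq 'X_[bmnm p.1] - 'X_[bmnm p.2] : {mpoly K[m]} | p : T <- enum {: T} &
    [&& eqdeg p.1 p.2, bmnm p.1 != M & bmnm p.2 != M]].
  have memS u v : (mdeg u < D)%N -> (mdeg v < D)%N -> eqdeg u v -> u != M -> v != M ->
      in_ideal S ('X_[u] - 'X_[v]).
    move=> hu hv duv uM vM; apply: in_ideal_mem; apply/mapP.
    exists (BMultinom hu, BMultinom hv); last by []. rewrite mem_filter /=. by rewrite duv uM vM /= mem_enum.
  have idS : forall u v, eqdeg u v -> in_ideal S ('X_[u] - 'X_[v]).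
    apply: in_ideal_pairs => u v duv len.
    have hu : (mdeg u < D)%N by rewrite ltnS leq_max len.
    have hv : (mdeg v < D)%N by rewrite -(eqdeg_mdeg ends2 duv).
    have base w : eqdeg M w -> w != M -> in_ideal S ('X_[M] - 'X_[w]).
      move=> dw nw; have mM : movable ends M by exists w.
      have [M' [lM' mM' neM']] : exists M', [/\ (M' <= M)%MM, movable ends M' & M' <> M].
        by apply: NNPP => h; apply: nM; split=> // w' l' m'; apply: NNPP => ne; apply: h; exists w'.
      have lt' : (mdeg M' < mdeg M)%N.
        by rewrite ltnNge; apply/negP => /(le_mdeg_eq lM').
      have [v' nv' dv'] := mM'.
      have mv' := eqdeg_mdeg ends2 dv'.
      have neq : (v' + (M - M'))%MM != M.
        by apply: contra nv' => /eqP e; apply/eqP; apply: (@addIm _ (M - M')%MM); rewrite e addmC submK.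
      have dd : eqdeg (v' + (M - M'))%MM M.
        by rewrite -{2}(submK lM') [(M - M' + M')%MM]addmC; apply: eqdegD; [rewrite eqdegC|exact: eqdeg_refl].
      (* The detour from [M] to [w] passes through the monomial obtained by replacing the proper
         movable divisor [M'] of [M]. *)
      have -> : 'X_[M] - 'X_[w] = 'X_[M - M'] * ('X_[M'] - 'X_[v']) + ('X_[v' + (M - M')] - 'X_[w]) :> {mpoly K[m]}.
        by rewrite mulrBr -!mpolyXD submK // [(M - M' + v')%MM]addmC addrA subrK.
      have leM : (mdeg M < D)%N by rewrite ltnS leq_max leqnn orbT.
      apply: in_idealD; first apply: in_idealM.
        apply: memS => //; [lia|lia|by apply/eqP|].
        by apply/eqP => e; rewrite e in mv'; lia.
      apply: memS => //.
      + by rewrite (eqdeg_mdeg ends2 dd).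
      + by rewrite -(eqdeg_mdeg ends2 dw).
      + exact: eqdeg_trans dw.
    have [uM|uM] := eqVneq u M; have [vM|vM] := eqVneq v M.
    + by rewrite uM vM subrr; apply: in_ideal0.
    + by rewrite uM; apply: base; rewrite // -uM.
    + rewrite -opprB vM -mulN1r; apply: in_idealM; apply: base => //.
      by rewrite -vM eqdegC.
    + exact: memS.
  have [|B /mapP[p]] := ind S.
    split=> [B /mapP[p _ ->]|P]; first by exists (bmnm p.1), (bmnm p.2).
    split; last first.
      case=> c ->; rewrite /in_toric /toric_map (raddf_sum (comp_mpoly _)) big1 // => i _.
      rewrite [LHS]toric_mapM; have /mapP[p] := mem_nth 0 (ltn_ord i).
      rewrite mem_filter => /andP[/and3P[d _ _] _] ->.
      by rewrite -/(toric_map _ _); have /toric_binomial -> := d; rewrite mulr0.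
    apply: toric_span => //; [exact: in_ideal0|exact: in_idealD|exact: in_idealM].
  rewrite mem_filter => /andP[/and3P[_ n1 n2] _] ->.
  rewrite /monomial_of mcoeff_msupp mcoeffB !mcoeffX.
  by rewrite (negbTE n1) (negbTE n2) subrr eqxx.
- have [v nv dMv] := mM.
  have /genS[c ec] : in_toric ends ('X_[M] - 'X_[v] : {mpoly K[m]}) by apply/toric_binomial.
  have : ('X_[M] - 'X_[v] : {mpoly K[m]})@_M != 0.
    by rewrite mcoeffB !mcoeffX eqxx (negbTE nv) subr0 oner_eq0.
  rewrite ec raddf_sum => sum0.
  have [i ci] : exists i, (c i * S`_i)@_M != 0.
    apply: NNPP => h; move/negP: sum0; apply; rewrite big1 // => i _; apply/eqP/negPn/negP => hi.
    by apply: h; exists i.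
  have BS := mem_nth 0 (ltn_ord i); set B := S`_i in ci BS.
  exists B => //.
  have /msuppM_le/allpairsP[[w u] /= [_ uB eM]] : M \in msupp (c i * B) by rewrite mcoeff_msupp.
  suff <- : u = M by [].
  apply: minM; first by rewrite eM lem_addl.
  have [u1 [u2 eB]] := binS B BS.
  have /genS := in_ideal_mem BS; rewrite eB => /toric_binomial d12.
  move: uB; rewrite eB mcoeff_msupp mcoeffB !mcoeffX.
  have [<-|n1] := eqVneq u1 u.
    have [<-|n2 _] := eqVneq u2 u1; first by rewrite subrr eqxx.
    by exists u2.
  have [e _|n2] := eqVneq u2 u; last by rewrite subrr eqxx.
  by exists u1; rewrite // -e eqdegC.
Qed.

End Indispensable.

(** * Walks as sequences *)

Section Sequences.
Variables (n m : nat) (ends : 'I_m -> {set 'I_n}).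
Hypothesis ends2 : forall i, #|ends i| = 2.
Hypothesis ends_inj : injective ends.
Implicit Types (M N R : 'X_{1..m}) (x : 'I_n).
Local Notation minmov := (minmov ends).
Local Notation eqdeg := (eqdeg ends).
Local Notation minwalk := (minwalk ends).

Lemma nth_rot1 (x0 : 'I_n) s k : k < size s -> nth x0 (rot 1 s) k = nth x0 s (k.+1 %% size s).
Proof.
case: s => // x s; rewrite rot1_cons nth_rcons /= ltnS => le.
by case: ltngtP le => // [lt|->] _; [rewrite modn_small|rewrite modnn].
Qed.

Lemma even_closed_walkP es vs (e0 : 'I_m) (x0 : 'I_n) :
  even_closed_walk ends es vs <->
  [/\ size es = size vs, 0 < size es, ~~ odd (size es) &
      forall k, k < size es -> ends (nth e0 es k) = [set nth x0 vs k; nth x0 vs (k.+1 %% size es)]].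
Proof.
split=> -[sz L0 oL h]; split=> //.
  move: h; rewrite all2E => /andP[_ /(all_nthP (e0, (x0, x0))) h] k kL.
  have := h k; rewrite !size_zip size_rot -sz !minnn => /(_ kL).
  rewrite !nth_zip ?size_zip ?size_rot -?sz ?minnn //= => /eqP->.
  by rewrite nth_rot1 -?sz.
rewrite all2E size_zip size_rot -sz minnn eqxx /=; apply/(all_nthP (e0, (x0, x0))) => k.
rewrite !size_zip size_rot -sz !minnn => kL.
rewrite !nth_zip ?size_zip ?size_rot -?sz ?minnn //=.
by rewrite h // nth_rot1 -?sz.
Qed.

Lemma closed_walk_cwalk es vs : even_closed_walk ends es vs -> exists e v,
  [/\ cwalk ends (size es) e v, es = mkseq e (size es) & vs = mkseq v (size es)].
Proof.
case: es => [|e0 es]; first by case.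
case: vs => [|x0 vs]; first by case.
move=> /(even_closed_walkP _ _ e0 x0); set s := e0 :: es; set t := x0 :: vs => -[sz L0 oL h].
exists (fun k => nth e0 s (k %% size s)), (fun k => nth x0 t (k %% size s)); split.
- split=> // k; rewrite ?modnDr // h ?ltn_mod //; congr [set _; nth _ _ _].
  by rewrite -addn1 modnDml addn1.
- rewrite -[LHS](mkseq_nth e0); apply/eq_in_map => k; rewrite mem_iota => /= kL.
  by rewrite modn_small.
- rewrite -[LHS](mkseq_nth x0) -sz; apply/eq_in_map => k; rewrite mem_iota => /= kL.
  by rewrite modn_small.
Qed.

Variables (L : nat) (e : nat -> 'I_m) (v : nat -> 'I_n).
Hypothesis W : cwalk ends L e v.
Local Notation es := (mkseq e L).
Local Notation vs := (mkseq v L).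

Lemma cwalk_closed_walk : even_closed_walk ends es vs.
Proof.
apply/(even_closed_walkP _ _ (e 0) (v 0)); rewrite !size_mkseq; split=> //.
- exact: L_gt0 W.
- exact: evenL W.
- move=> k kL; rewrite !nth_mkseq ?ltn_mod ?(L_gt0 W) // (ev W); congr [set _; _].
  by have [->] := cwalk_mod k.+1 W.
Qed.

Lemma mem_es k : e k \in es.
Proof.
have [_ <-] := cwalk_mod k W; apply/mapP; exists (k %% L) => //.
by rewrite mem_iota ltn_mod (L_gt0 W).
Qed.

Lemma esP f : f \in es -> exists2 k, k < L & f = e k.
Proof. by case/mapP => k; rewrite mem_iota => kL ->; exists k. Qed.

Lemma mask_es (b : bool) : mask (map (addb b) (odd_pos es)) es = map e [seq k <- iota 0 L | odd k == b].
Proof.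
rewrite /odd_pos size_mkseq -map_comp -map_mask filter_mask; congr (map e (mask _ _)).
by apply: eq_map => k /=; case: (odd k); case: b.
Qed.

Lemma mask_es_false : mask (odd_pos es) es = map e [seq k <- iota 0 L | odd k == false].
Proof. by rewrite -mask_es map_id. Qed.

Lemma mask_es_true : mask (map negb (odd_pos es)) es = map e [seq k <- iota 0 L | odd k == true].
Proof. by rewrite -mask_es. Qed.

Lemma odd_edgeP f : odd_edge es f -> 0 < wpart L e false f.
Proof.
rewrite /odd_edge mask_es_false => /mapP[k]; rewrite mem_filter => /andP[/eqP ok kL] ->.
by apply/partP; exists k.
Qed.

Lemma even_edgeP f : even_edge es f -> 0 < wpart L e true f.
Proof.
rewrite /even_edge mask_es_true => /mapP[k]; rewrite mem_filter => /andP[/eqP ok kL] ->.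
by apply/partP; exists k.
Qed.

Lemma same_parity_edges k k' : k < L -> k' < L -> odd k = odd k' ->
  (odd_edge es (e k) && odd_edge es (e k')) || (even_edge es (e k) && even_edge es (e k')).
Proof.
move=> kL kL' ok; rewrite /odd_edge /even_edge mask_es_false mask_es_true.
by apply/orP; case o: (odd k); [right|left]; apply/andP; split; apply: map_f;
  rewrite mem_filter mem_iota ?kL ?kL' -?ok ?o.
Qed.

Lemma B_walkE (K : fieldType) :
  B_walk K es = ('X_[wpart L e false] - 'X_[wpart L e true])%R.
Proof.
rewrite /B_walk mask_es_false mask_es_true !big_map !big_filter.
by rewrite /wpart /part !(big_morph _ (@mpolyXD m K) (@mpolyX0 m K)).
Qed.

Lemma monomial_B_walk (K : fieldType) M : monomial_of M (B_walk K es) =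
  (wpart L e false != wpart L e true) && ((M == wpart L e false) || (M == wpart L e true)).
Proof.
rewrite /monomial_of B_walkE mcoeff_msupp mcoeffB !mcoeffX ![_ == M]eq_sym.
have [->|ne] := eqVneq (wpart L e false) (wpart L e true); first by rewrite subrr eqxx.
have [->|_] := eqVneq M (wpart L e false); first by rewrite (negbTE ne) subr0 oner_eq0.
by case: (M == _); rewrite /= ?sub0r ?oppr_eq0 ?oner_eq0 ?subr0 ?eqxx.
Qed.

(** Opposite sides of a 4-cycle form two perfect matchings of the same four vertices. *)
Lemma cycle4_movable f1 f2 f3 f4 (N : 'X_{1..m}) : cycle4 ends f1 f2 f3 f4 -> f2 != f1 -> f2 != f3 ->
  0 < N f1 -> 0 < N f3 -> (U_(f1) + U_(f3) <= N)%MM /\ movable ends (U_(f1) + U_(f3))%MM.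
Proof.
case=> a [b [c [d [u h1 h2 h3 h4]]]] n1 n3 N1 N3.
have n13 : f1 != f3.
  apply/eqP => e13; have : a \in ends f3 by rewrite -e13 h1 set21.
  by move: u; rewrite h3 !inE /= !inE !negb_or => /andP[/and3P[_ /negbTE-> /negbTE->]].
split.
  apply/mnm_lepP => i; rewrite mnmDE !mnm1E; case: eqP => [<-|_]; last by case: eqP => [<-|].
  by rewrite eq_sym (negbTE n13).
exists (U_(f2) + U_(f4))%MM.
  apply/eqP => /mnmP/(_ f2); rewrite !mnmDE !mnm1E eqxx ![_ == f2]eq_sym.
  by rewrite (negbTE n1) (negbTE n3).
apply/eqdegP => x; rewrite !adegD !adegU.
rewrite (mem_ends ends2 _ h1) (mem_ends ends2 _ h2) (mem_ends ends2 _ h3) (mem_ends ends2 _ h4).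
by lia.
Qed.

(** This is how an [F_4] forces a walk with two minimal halves to be quadratic. *)
Lemma has_F4_movable : has_F4 ends es vs ->
  exists b u, [/\ (u <= wpart L e b)%MM, movable ends u & mdeg u = 2].
Proof.
case=> f1 [f2 [f3 [f4 [t [j [t' [j' [cyc [m1 m3] par [[[x [y [_ _ _ nf2 _]]] _ _ _] _] _]]]]]]]].
have n1 : f2 != f1 by apply: contraNneq nf2 => ->.
have n3 : f2 != f3 by apply: contraNneq nf2 => ->.
have md : mdeg (U_(f1) + U_(f3))%MM = 2 by rewrite mdegD !mdeg1.
case/orP: par => /andP[].
  move=> /odd_edgeP N1 /odd_edgeP N3; exists false, (U_(f1) + U_(f3))%MM.
  by have [] := cycle4_movable cyc n1 n3 N1 N3.
move=> /even_edgeP N1 /even_edgeP N3; exists true, (U_(f1) + U_(f3))%MM.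
by have [] := cycle4_movable cyc n1 n3 N1 N3.
Qed.

(** * Blocks and odd chords of an even cycle *)

Section Block.
Hypothesis vI : forall i j, i < j < L -> v i <> v j.

Lemma vsP x : reflect (exists2 k, k < L & x = v k) (x \in vs).
Proof.
apply: (iffP mapP) => [[k]|[k kL ->]]; first by rewrite mem_iota => kL ->; exists k.
by exists k; rewrite // mem_iota.
Qed.

Lemma mem_vs k : v k \in vs.
Proof.
have [<- _] := cwalk_mod k W; apply/vsP; exists (k %% L) => //.
by rewrite ltn_mod (L_gt0 W).
Qed.

Lemma sub_relC S F : ssrbool.symmetric (sub_rel ends S F).
Proof. by move=> x y; rewrite /sub_rel setUC andbCA. Qed.

Lemma connect_arc (S : {set 'I_n}) (F : {set 'I_m}) i j : i <= j -> (forall k, i <= k <= j -> v k \in S) ->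
  (forall k, i <= k < j -> e k \in F) -> connect (sub_rel ends S F) (v i) (v j).
Proof.
move=> /subnKC <-; elim: (j - i) => [|d IH] hS hF; first by rewrite addn0.
apply: connect_trans (IH _ _) _ => [k hk|k hk|]; [by apply: hS; lia|by apply: hF; lia|].
rewrite addnS; apply: connect1; rewrite /sub_rel !hS; [|lia|lia].
apply/existsP; exists (e (i + d)); rewrite hF ?(ev W) ?eqxx //; lia.
Qed.

(** Deleting [v r] leaves the arc from [r + 1] to [r + L - 1], in periodic indices, through all
    other vertices. *)
Lemma cycle_nonsep : nonsep ends [set x in vs] [set i in es].
Proof.
have conn_from (S : {set 'I_n}) (F : {set 'I_m}) a : (forall x, x \in S -> exists2 k, connect (sub_rel ends S F) (v a) (v k) & x = v k) ->
    sg_connected ends S F.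
  move=> h; apply/forall_inP => x /h[k ck ->]; apply/forall_inP => y /h[l cl ->].
  by apply: connect_trans cl; rewrite (sym_connect_sym (@sub_relC S F)).
apply/and3P; split.
- by apply/set0Pn; exists (v 0); rewrite inE mem_vs.
- apply: (conn_from _ _ 0) => x; rewrite inE => /vsP[k kL ->]; exists k => //.
  by apply: connect_arc => // l _; rewrite inE ?mem_vs ?mem_es.
apply/forallP => y; rewrite /cut_vertex negb_and negbK inE -implybE.
apply/implyP => /vsP[r rL ->].
have ne k : r < k < r + L -> v k <> v r.
  move=> hk ek; have [kL|Lk] := ltnP k L; first by apply: (@vI r k) => //; lia.
  by apply: (@vI (k - L) r); [lia|rewrite -ek -(vL W (k - L)) subnK].
apply: (conn_from _ _ r.+1) => x; rewrite !inE => /andP[xr /vsP[k kL ex]].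
have [l hl el] : exists2 l, r < l < r + L & v l = x.
  case: (ltngtP k r) => hk; first by exists (k + L); [lia|rewrite (vL W)].
    by exists k => //; lia.
  by rewrite ex hk eqxx in xr.
exists l => //; apply: connect_arc; first by lia.
  by move=> i hi; rewrite !inE mem_vs andbT; apply/eqP/ne; lia.
move=> i hi; rewrite !inE mem_es (ev W) !inE negb_or /=.
by apply/andP; split; apply/eqP => /esym; apply: ne; lia.
Qed.

Lemma cycle_same_block x y : x \in vs -> y \in vs -> same_block ends es vs x y.
Proof.
move=> xv yv; exists [set x in vs], [set i in es]; split; rewrite ?inE //; split.
- apply/and3P; split=> //; apply/forall_inP => i; rewrite inE => /esP[k _ ->].
  by rewrite (ev W); apply/subsetP => z /set2P[]->; rewrite inE mem_vs.
- exact: cycle_nonsep.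
- move=> S F /and3P[h1 h2 _] _ h3 h4.
  by split; apply/eqP; rewrite eqEsubset ?h1 ?h2 ?h3 ?h4.
Qed.

(** The whole cycle is a single block, so none of its chords is a bridge. *)
Lemma cycle_odd_chord f t j : t < j < L -> ~~ odd (j - t) -> (forall k, e k != f) ->
  ends f = [set v t; v j] -> odd_chord ends es vs f t j.
Proof.
move=> htj otj nf ef.
have at_v k : k < L -> at_pos vs k (v k).
  by move=> kL; rewrite /at_pos size_mkseq kL nth_mkseq // eqxx.
have oL := evenL W; split.
- exists (v t), (v j); split=> //; [lia|apply: at_v; lia|apply: at_v; lia|].
  by apply/negP => /esP[k _ fk]; have := nf k; rewrite fk eqxx.
- case=> _ [x [y [/andP[h1 /eqP h2] /andP[h3 /eqP h4] nb]]]; apply: nb.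
  by apply: cycle_same_block; [rewrite -h2|rewrite -h4]; apply: mem_nth.
- by rewrite /gamma1_length size_mkseq; lia.
- by rewrite /gamma2_length; lia.
Qed.

Lemma interleaved_has_F4 c f f' t j t' j' : minwalk L e v c ->
  interleaved ends L e v f f' t j t' j' -> has_F4 ends es vs.
Proof.
move=> MW il; have [k [k' [hk ok cyc]]] := interleaved_cycle4 ends2 MW vI il.
have [[ef ef'] [nf nf'] /and4P[h1 h2 h3 h4] [o1 o2 o3]] := il.
have oc : odd_chord ends es vs f t j by apply: cycle_odd_chord => //; lia.
have oc' : odd_chord ends es vs f' t' j' by apply: cycle_odd_chord => //; lia.
have par : (odd_edge es (e k) && odd_edge es (e k')) || (even_edge es (e k) && even_edge es (e k')).
  by apply: same_parity_edges => //; lia.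
have mk : e k \in es /\ e k' \in es by rewrite !mem_es.
case: cyc => cyc.
- exists (e k), f, (e k'), f', t, j, t', j'; split=> //.
  by rewrite /cross_effectively; lia.
- exists (e k), f', (e k'), f, t', j', t, j; split=> //.
  by rewrite /cross_effectively; lia.
Qed.

End Block.
End Sequences.

(** * The complex of minimal supports *)

Section MinimalSupports.
Variables (K : fieldType) (n m : nat) (ends : 'I_m -> {set 'I_n}).
Hypothesis ends2 : forall i, #|ends i| = 2.
Hypothesis ends_inj : injective ends.
Hypothesis sharp : cond_sharp ends.
Implicit Types (M N R : 'X_{1..m}) (x : 'I_n) (E : {set 'I_m}).
Local Notation minmov := (minmov ends).
Local Notation eqdeg := (eqdeg ends).
Local Notation minwalk := (minwalk ends).

(** The halves of an extracted walk divide [M] and [N], which are disjoint, so they differ;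
    minimality then makes the first one all of [M]. *)
Lemma minmov_walk M N : minmov M -> eqdeg M N -> N != M -> exists L e v,
  [/\ minwalk L e v false, wpart L e false = M & (wpart L e true <= N)%MM].
Proof.
move=> mM dMN neN; have [_ minM] := mM.
have M0 : M != 0%MM.
  apply: contraNneq neN => M0; have := eqdeg_mdeg ends2 dMN.
  by rewrite M0 mdeg0 => /esym/eqP; rewrite mdeg_eq0.
have [L [e [v [W lM lN]]]] := walk_extract ends2 dMN M0.
have neq : wpart L e false != wpart L e true.
  apply/eqP => ew; have w0 : 0 < wpart L e false (e 0).
    by apply/partP; exists 0; rewrite mem_iota (L_gt0 W).
  have Me : 0 < M (e 0) by apply: leq_trans w0 _; apply/mnm_lepP.
  have Ne : 0 < N (e 0) by apply: leq_trans w0 _; rewrite ew; apply/mnm_lepP.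
  by have := minmov_disjoint mM neN dMN Me; lia.
have eM : wpart L e false = M.
  apply: minM lM _; exists (wpart L e true); first by rewrite eq_sym.
  exact: (wpart_eqdeg ends2 false W).
by exists L, e, v; split=> //; split=> //; rewrite eM.
Qed.

Lemma minmov_walk2 M N : minmov M -> minmov N -> eqdeg M N -> N != M -> exists L e v,
  [/\ minwalk L e v false, wpart L e false = M & wpart L e true = N].
Proof.
move=> mM [_ minN] dMN neN; have [L [e [v [MW eM lN]]]] := minmov_walk mM dMN neN.
exists L, e, v; split=> //; have [W _ neq] := MW.
apply: minN lN _; exists (wpart L e false) => //.
by rewrite eqdegC; exact: (wpart_eqdeg ends2 false W).
Qed.

Lemma walk_vertex L e v M x c : cwalk ends L e v -> wpart L e c = M -> 0 < adeg ends M x ->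
  exists k, x = v k.
Proof.
move=> W <- /adeg_gt0[i xi /partP[k [_ _ ek]]].
by move: xi; rewrite -ek (ev W) => /set2P[]->; [exists k|exists k.+1].
Qed.

(** The alternatives serve to recover a degree from its vertex set: a matching has degrees 0 and 1,
    and a figure eight leaves one other candidate. *)
Lemma minmov_type M : minmov M -> (forall i, M i <= 1) /\
  ((forall x, adeg ends M x <= 1) \/
   exists2 M2, eqdeg M M2 & forall M', minmov M' ->
     (forall x, 0 < adeg ends M' x -> 0 < adeg ends M x) -> M' = M \/ M' = M2).
Proof.
move=> mM; have [[N neN dN] _] := mM.
have [L [e [v [MW eM _]]]] := minmov_walk mM dN neN.
have [le1 cases] := minwalk_cases ends2 ends_inj sharp MW.
have [W _ neq] := MW.
split; first by rewrite -eM; apply: le1.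
case: cases => [vI|above]; [left|right].
  by move=> x; rewrite -eM; apply: (adeg_wpart_le1 ends2 MW vI).
exists (wpart L e true); first by rewrite -eM; exact: (wpart_eqdeg ends2 false W).
move=> M' [[R neR dR] minM'] hM'.
have [|x /hM'|l|l] := above M' R dR.
- by apply/eqP; rewrite eq_sym.
- exact: walk_vertex W eM.
- by left; rewrite -eM; apply/esym/minM' => //; rewrite eM; case: mM.
- right; apply/esym/minM' => //; exists (wpart L e false) => //.
  by rewrite eqdegC; exact: (wpart_eqdeg ends2 false W).
Qed.

Definition ind E : 'X_{1..m} := [multinom (i \in E) : nat | i < m].

Lemma indE E i : ind E i = (i \in E). Proof. exact: mnmE. Qed.

Lemma supp_ind E : supp (ind E) = E.
Proof. by apply/setP => i; rewrite inE indE; case: (i \in E). Qed.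

Lemma ind_supp M : (forall i, M i <= 1) -> ind (supp M) = M.
Proof. by move=> le1; apply/mnmP => i; rewrite indE inE; have := le1 i; lia. Qed.

(** Indispensable monomials are squarefree, so inclusion of supports is divisibility and all their
    supports are inclusion-minimal. *)
Lemma Tmin_ind E : Tmin ends K E <-> minmov (ind E).
Proof.
split=> [[[M /(indispensable_minmov K ends2) mM <-] _]|mE].
  by rewrite ind_supp //; case: (minmov_type mM).
split; first by exists (ind E); [apply/(indispensable_minmov K ends2)|exact: supp_ind].
case=> M /(indispensable_minmov K ends2) mM /properP[/subsetP sub [i iE]].
have [le1 _] := minmov_type mM.
have : M = ind E.
  apply: (proj2 mE); last by case: mM.
  apply/mnm_lepP => j; rewrite indE; have := le1 j; have := sub j; rewrite inE.
  by case: (M j) => // k /(_ isT)->.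
by move=> ->; rewrite supp_ind iE.
Qed.

Lemma Tmin_supp M : minmov M -> Tmin ends K (supp M).
Proof. by move=> mM; apply/Tmin_ind; rewrite ind_supp //; case: (minmov_type mM). Qed.

Lemma face_eqdeg (F : {set {set 'I_m}}) : F != set0 -> (forall E, E \in F -> Tmin ends K E) ->
  (forall E E', E \in F -> E' \in F -> eqdeg (ind E) (ind E')) -> face ends K F.
Proof.
move=> F0 FT Fd; split=> //; split=> //; exists ind; split=> [E _|E E' EF EF']; first exact: supp_ind.
exact/eqdegP/Fd.
Qed.

Lemma supp_adeg M N x : supp M = supp N -> 0 < adeg ends M x -> 0 < adeg ends N x.
Proof.
move=> /setP es /adeg_gt0[i xi Mi]; have := es i; rewrite !inE Mi => /esym Ni.
exact: leq_trans Ni (leq_adeg _ xi).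
Qed.

(** The monomials provided by the face need not be squarefree, but they show that [E] and [E'] cover
    the same vertices. From this [minmov_type] deduces equality of the degrees. *)
Lemma gadj_eqdeg E E' : gadj ends K E E' ->
  [/\ minmov (ind E), minmov (ind E') & eqdeg (ind E) (ind E')].
Proof.
case=> neE [_ [FT [Mon [sM dM]]]].
have ET := FT E (set21 _ _); have ET' := FT E' (set22 _ _).
have mE : minmov (ind E) by apply/Tmin_ind.
have mE' : minmov (ind E') by apply/Tmin_ind.
split=> //.
have sE := sM E (set21 _ _); have sE' := sM E' (set22 _ _).
have dEE' := dM E E' (set21 _ _) (set22 _ _).
have vE x : (0 < adeg ends (ind E) x) = (0 < adeg ends (ind E') x).
  apply/idP/idP => h.
    apply: (@supp_adeg (Mon E')); first by rewrite supp_ind.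
    by rewrite -dEE'; apply: (supp_adeg _ h); rewrite supp_ind.
  apply: (@supp_adeg (Mon E)); first by rewrite supp_ind.
  by rewrite dEE'; apply: (supp_adeg _ h); rewrite supp_ind.
have [_ [le1|[M2 d2 h2]]] := minmov_type mE.
  have [_ [le1'|[M2 d2 h2]]] := minmov_type mE'.
    by apply/eqdegP => x; have := vE x; have := le1 x; have := le1' x; lia.
  have [x|->|->] := h2 _ mE; [by rewrite vE|exact: eqdeg_refl|by rewrite eqdegC].
have [x|->|->] := h2 _ mE'; [by rewrite vE|exact: eqdeg_refl|exact: d2].
Qed.

Lemma eqdeg_gadj E E' : minmov (ind E) -> minmov (ind E') -> eqdeg (ind E) (ind E') ->
  E != E' -> gadj ends K E E'.
Proof.
move=> mE mE' d ne; split=> //; apply: face_eqdeg.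
- by apply/set0Pn; exists E; rewrite set21.
- by move=> F /set2P[]->; apply/Tmin_ind.
- by move=> F F' /set2P[]-> /set2P[]->; rewrite ?eqdeg_refl // eqdegC.
Qed.

Lemma component_minmov C E : component ends K C -> E \in C -> minmov (ind E).
Proof. by case=> _ CT _ _ EC; apply/Tmin_ind/CT. Qed.

Lemma component_eqdeg C E E' : component ends K C -> E \in C -> E' \in C -> eqdeg (ind E) (ind E').
Proof.
case=> _ _ conn _ EC EC'; elim: (conn E E' EC EC') => [F F' /gadj_eqdeg[]//|F|F1 F2 F3 _ h1 _ h2].
  exact: eqdeg_refl.
exact: eqdeg_trans h1 h2.
Qed.

(* If [w] has no repeated vertex and its other monomial is not indispensable,
   an indispensable divisor of the latter together with another monomial of its
   fibre is a matching which must contain two effectively crossing chords. *)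
Lemma minwalk_F4 L e v c : minwalk L e v c -> ~ minmov (wpart L e (~~ c)) ->
  has_F4 ends (mkseq e L) (mkseq v L).
Proof.
move=> MW nM'; have [W mM neq] := MW.
have dW := wpart_eqdeg ends2 c W.
have neq' : wpart L e c != wpart L e (~~ c) by case: (c) neq => //; rewrite eq_sym.
have mov' : movable ends (wpart L e (~~ c)) by exists (wpart L e c); rewrite 1?eqdegC.
have [_ [vI|above]] := minwalk_cases ends2 ends_inj sharp MW; last first.
  (* With a repeated vertex, a movable divisor of the other half is a multiple of one of the halves;
     these have equal degree, so it is all of that half. *)
  case: nM'; split=> // u leu [R neR dR].
  have lW : wpart L e c = u \/ wpart L e (~~ c) = u -> u = wpart L e (~~ c).
    case=> [eu|//]; have := le_mdeg_eq leu; rewrite -eu; apply.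
    by rewrite (eqdeg_mdeg ends2 dW).
  have mle b : (wpart L e b <= u)%MM -> wpart L e b = u.
    move=> le; apply: le_mdeg_eq => //; have := le_mdeg leu; have := eqdeg_mdeg ends2 dW.
    by case: (b); case: (c) => /=; lia.
  have [||l|l] := above u R dR; first by apply/eqP; rewrite eq_sym.
  - by move=> x h; apply: (walk_vertex W (erefl (wpart L e (~~ c)))); apply: leq_trans h (adeg_le _ _ leu).
  - by apply: lW; have := mle _ l; case: (c) => /= ->; [right|left].
  - by apply: lW; have := mle _ l; case: (c) => /= ->; [left|right].
have [N mN leN] := minmov_below mov'.
have neN : N <> wpart L e (~~ c) by move=> eN; apply: nM'; rewrite -eN.
have [[R neR dR] _] := mN.
have disj i : 0 < N i -> R i = 0 by apply: minmov_disjoint mN neR dR.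
have N0 : N <> 0%MM.
  move=> N0; move/eqP: neR; apply; have := eqdeg_mdeg ends2 dR.
  by rewrite N0 mdeg0 => /esym/eqP; rewrite mdeg_eq0 => /eqP.
(* Equality would give [N] the full degree of the half that it properly divides. *)
have RM : R <> wpart L e c.
  move=> eR; apply: neN; apply: le_mdeg_eq => //.
  by rewrite -(eqdeg_mdeg ends2 dW) (eqdeg_mdeg ends2 dR) eR.
have [f1 [f2 [t1 [j1 [t2 [j2 [_ _ il]]]]]]] := matching_crosses ends2 ends_inj MW vI leN dR disj N0 RM.
exact: (interleaved_has_F4 ends2 W vI MW il).
Qed.

(** If the support is isolated, the other half of [w] is not indispensable and [minwalk_F4] applies.
    Conversely, a neighbour would be the other half of a walk whose [F_4] makes one half, and hence
    [M], quadratic. *)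
Lemma component_iff_F4 M : indispensable ends K M -> ~~ quadratic M ->
  (component ends K [set supp M] <->
   forall es vs, even_closed_walk ends es vs -> monomial_of M (B_walk K es) -> has_F4 ends es vs).
Proof.
move=> /(indispensable_minmov K ends2) mM nq.
have [le1 _] := minmov_type mM; have eM := ind_supp le1.
split=> [comp es vs ecw|allF4].
  have [e [v [W ees evs]]] := closed_walk_cwalk ecw; move: W ees evs.
  move: (size es) => L W -> ->.
  rewrite monomial_B_walk => /andP[neq hM].
  have [c ec] : exists c, M = wpart L e c by case/orP: hM => /eqP->; [exists false|exists true].
  have MW : minwalk L e v c by split=> //; rewrite -ec.
  apply: (minwalk_F4 MW) => mM'.
  have [le1' _] := minmov_type mM'; have eM' := ind_supp le1'.
  have neM : M != wpart L e (~~ c) by rewrite ec; case: (c) neq => //; rewrite eq_sym.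
  have ne : supp M != supp (wpart L e (~~ c)).
    by apply: contra neM => /eqP e1; rewrite -eM -eM' e1.
  have [_ _ _ /(_ (supp M) (supp (wpart L e (~~ c))) (set11 _))] := comp.
  rewrite inE eq_sym (negbTE ne) => H; apply: notF; apply: H.
  apply: eqdeg_gadj; rewrite ?eM ?eM' //.
  by rewrite ec; exact: (wpart_eqdeg ends2 c W).
split.
- by apply/set0Pn; exists (supp M); rewrite set11.
- by move=> E /set1P->; apply: Tmin_supp.
- by move=> E E' /set1P-> /set1P->; apply: rt_refl.
move=> E E' /set1P-> /[dup] -[neE _] /gadj_eqdeg[]; rewrite eM => _ mE' d.
have neM : ind E' != M.
  by apply: contra neE => /eqP <-; rewrite supp_ind.
have [L [e [v [MW e0 e1]]]] := minmov_walk2 mM mE' d neM.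
have [W _ neq] := MW.
have F4 : has_F4 ends (mkseq e L) (mkseq v L).
  apply: allF4; first exact: (cwalk_closed_walk W).
  by rewrite monomial_B_walk neq e0 eqxx.
have [b [u [leu mu du]]] := has_F4_movable ends2 F4.
case/negP: nq; rewrite /quadratic.
case: b leu => leu; last by rewrite -(proj2 mM u) ?du // -e0.
by rewrite (eqdeg_mdeg ends2 d) -(proj2 mE' u) ?du // -e1.
Qed.

(** The degree lives on at most four vertices. Once one of them, [x], is fixed, the supports are
    told apart by the partner of [x], because distinct ones are disjoint. *)
Lemma component_quadratic_card C E0 : component ends K C -> E0 \in C -> mdeg (ind E0) = 2 -> #|C| <= 3.
Proof.
move=> comp E0C d2; have mm E EC := component_minmov (E := E) comp EC.
have dC E E' EC EC' := component_eqdeg (E := E) (E' := E') comp EC EC'.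
have [i0 i0E] : exists i, i \in E0.
  apply/set0Pn; apply/eqP => E00; move: d2; rewrite E00 => /eqP.
  by rewrite (_ : ind set0 = 0%MM) ?mdeg0 //; apply/mnmP => i; rewrite indE mnm0E inE.
have /card_gt0P[x xi0] : 0 < #|ends i0| by rewrite ends2.
have x0 : 0 < adeg ends (ind E0) x by apply: leq_trans (leq_adeg _ xi0); rewrite indE i0E.
pose V := [set y | 0 < adeg ends (ind E0) y].
have V4 : #|V| <= 4.
  rewrite -[4]/(2 * 2) -{2}d2 -(sum_adeg ends2).
  rewrite -sum1_card big_mkcond; apply: leq_sum => y _; rewrite inE.
  by case: ifP.
pose phi E := odflt i0 [pick i in E | x \in ends i].
have phiP E : E \in C -> phi E \in E /\ x \in ends (phi E).
  move=> EC; rewrite /phi; case: pickP => [i /andP[]//|none].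
  have : 0 < adeg ends (ind E) x by rewrite (eqdegP _ _ _ (dC _ _ EC E0C)).
  case/adeg_gt0 => i xi; rewrite indE lt0b => iE.
  by have := none i; rewrite /= iE xi.
pose psi E := ends (phi E) :\ x.
have psi_inj : {in C &, injective psi}.
  move=> E E' EC EC' epsi; have [pE pxE] := phiP E EC; have [pE' pxE'] := phiP E' EC'.
  have ephi : phi E = phi E' by apply: ends_inj; rewrite -(setD1K pxE) -(setD1K pxE') -/(psi E) epsi.
  apply/eqP/negPn/negP => ne.
  have neI : ind E' != ind E by apply: contra ne => /eqP e1; rewrite -(supp_ind E) -e1 supp_ind.
  have := minmov_disjoint (i := phi E) (mm E EC) neI (dC _ _ EC EC').
  by rewrite !indE pE ephi pE' => /(_ isT).
rewrite -(card_in_imset psi_inj).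
apply: (@leq_trans #|[set [set y] | y in V :\ x]|); last first.
  apply: leq_trans (leq_imset_card _ _) _; rewrite -ltnS; apply: leq_trans V4.
  by rewrite (cardsD1 x V) inE x0.
apply/subset_leq_card/subsetP => A /imsetP[E EC ->].
have [pE pxE] := phiP E EC; rewrite /psi.
have /eqP/cards1P[y ey] : #|ends (phi E) :\ x| = 1.
  by have := cardsD1 x (ends (phi E)); rewrite ends2 pxE; lia.
have : y \in ends (phi E) :\ x by rewrite ey set11.
rewrite !inE => /andP[yx yE].
rewrite ey; apply/imsetP; exists y => //; rewrite !inE yx /=.
rewrite (eqdegP _ _ _ (dC _ _ E0C EC)); apply: leq_trans (leq_adeg _ yE).
by rewrite indE pE.
Qed.

(** Without quadratic monomials even three supports are impossible. Two of them are the halves of a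
    walk; for a figure eight the third would equal a half, and for an even cycle it contains
    crossing chords, whose [F_4] makes the component quadratic. *)
Lemma component_card C : component ends K C -> #|C| <= 3.
Proof.
move=> comp; rewrite leqNgt; apply/negP => C4.
have mm E EC := component_minmov (E := E) comp EC.
have dC E E' EC EC' := component_eqdeg (E := E) (E' := E') comp EC EC'.
have /card_gt2P[E1 [E2 [E3 [[C1 C2 C3] [n12 n23 n31]]]]] : 2 < #|C| by lia.
have q E : E \in C -> mdeg (ind E) <> 2.
  by move=> EC q; have := component_quadratic_card comp EC q; lia.
have nI E E' : E != E' -> ind E != ind E'.
  by apply: contra => /eqP h; rewrite -(supp_ind E) h supp_ind.
have [L [e [v [MW e0 e1]]]] := minmov_walk2 (mm _ C1) (mm _ C2) (dC _ _ C1 C2) ltac:(by apply: nI; rewrite eq_sym).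
have [W _ neq] := MW.
have [_ [vI|above]] := minwalk_cases ends2 ends_inj sharp MW; last first.
  have [||l|l] := above (ind E3) (ind E1) (dC _ _ C3 C1); first by apply/eqP/nI.
  - move=> x; rewrite (eqdegP _ _ _ (dC _ _ C3 C1)); exact: walk_vertex W e0.
  - have eE : wpart L e false = ind E3.
      by apply: (proj2 (mm _ C3)) l _; rewrite e0; case: (mm _ C1).
    by move: (nI _ _ n31); rewrite -eE e0 eqxx.
  - have eE : wpart L e true = ind E3.
      by apply: (proj2 (mm _ C3)) l _; rewrite e1; case: (mm _ C2).
    by move: (nI _ _ n23); rewrite -eE e1 eqxx.
have disj i : 0 < ind E2 i -> ind E3 i = 0.
  apply: minmov_disjoint (mm _ C2) _ (dC _ _ C2 C3); by apply: nI; rewrite eq_sym.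
have N0 : ind E2 <> 0%MM.
  move=> h; have [[R neR dR] _] := mm _ C2; case/eqP: neR; rewrite h in dR *.
  by have := eqdeg_mdeg ends2 dR; rewrite mdeg0 => /esym/eqP; rewrite mdeg_eq0 => /eqP.
have le2 : (ind E2 <= wpart L e (~~ false))%MM by rewrite /= e1 lepm_refl.
have ne3 : ind E3 <> wpart L e false by rewrite e0; apply/eqP/nI.
have [f1 [f2 [t1 [j1 [t2 [j2 [_ _ il]]]]]]] :=
  matching_crosses ends2 ends_inj MW vI le2 (dC _ _ C2 C3) disj N0 ne3.
have F4 := interleaved_has_F4 ends2 W vI MW il.
have [[] [u [leu mu du]]] := has_F4_movable ends2 F4.
- by apply: (q E2 C2); rewrite -(proj2 (mm _ C2) u) // -e1.
- by apply: (q E1 C1); rewrite -(proj2 (mm _ C1) u) // -e0.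
Qed.

End MinimalSupports.

Theorem theorem3p11 (K : fieldType) (n m : nat) (ends : 'I_m -> {set 'I_n}) :
  simple_graph ends -> connected_graph ends -> cond_sharp ends ->
  (forall M : 'X_{1..m}, indispensable ends K M -> ~~ quadratic M ->
     (component ends K [set supp M] <->
      forall (es : seq 'I_m) (vs : seq 'I_n), even_closed_walk ends es vs ->
        monomial_of M (B_walk K es) -> has_F4 ends es vs)) /\
  (forall C : {set {set 'I_m}}, component ends K C ->
     [\/ #|C| = 1%N, #|C| = 2%N /\ face ends K C | #|C| = 3%N /\ face ends K C]).
Proof.
move=> [ends2 ends_inj] _ sharp; split; first exact: component_iff_F4.
move=> C comp; have C3 := component_card ends2 ends_inj sharp comp.
have [C0 CT _ _] := comp; have C1 : 0 < #|C| by rewrite card_gt0.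
(* The squarefree monomials of a component share one degree, so the component is itself a face. *)
have fC : face ends K C.
  by apply: face_eqdeg => // E E'; apply: (component_eqdeg ends2 ends_inj sharp comp).
by case: (#|C|) C1 C3 => [//|[|[|[|//]]]] _ _; [constructor 1|constructor 2|constructor 3].
Qed.
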